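(* Let $r,w,c\ge 1$ be integers, $a:=r/c$, $b:=w/c$, and for $n\in\mathbb{N}$, $n\ge 1$, let $V=V_n=\frac1n S_n$ be the relative number of red balls among the first $n$ drawings from the Polya urn with parameters $r,w,c$. There exist finite constants $C_1,C_2$ depending only on $a$ and $b$ such that (P) $\|f_h'\|_\infty\le C_1\|h'\|_\infty$ for every Lipschitz continuous $h:\mathbb{R}\to\mathbb{R}$, and $\|f_h''\|_\infty\le C_2(\|h'\|_\infty+\|h''\|_\infty)$ for every twice differentiable $h:\mathbb{R}\to\mathbb{R}$ with bounded first and second derivative, where $f_h$ is the solution of the Stein equation for $\nu_{a,b}$ described in the context. For any such constants, for every $n\ge1$ and every twice differentiable function $h:\mathbb{R}\to\mathbb{R}$ with bounded first and second derivative, $$\bigl|E[h(V_n)]-\nu_{a,b}(h)\bigr|\le\Bigl(C_1\|h'\|_\infty\frac{|a-b|+a}{2}+C_2\bigl(\|h'\|_\infty+\|h''\|_\infty\bigr)\Bigl(\frac16+\frac{a+b-1}{6n}\Bigr)\Bigr)\frac1n .$$ In particular, the left-hand side is $O(1/n)$ as $n\to\infty$.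
   Context: Polya urn: an urn initially contains $r$ red and $w$ white balls. At each time $n=1,2,\dots$ a ball is drawn uniformly at random from the urn, its colour is noted, and it is returned together with $c$ further balls of the same colour. $X_n$ is the indicator of the event that the $n$-th drawn ball is red, and $S_n=\sum_{j=1}^nX_j$. For $a,b>0$, $\nu_{a,b}$ is the Beta distribution on $[0,1]$ with density $q_{a,b}(x)=\frac{1}{B(a,b)}x^{a-1}(1-x)^{b-1}1_{(0,1)}(x)$, $B(a,b)=\int_0^1x^{a-1}(1-x)^{b-1}dx$, and $\nu_{a,b}(h)=\int h\,d\nu_{a,b}$. The Stein equation for $\nu_{a,b}$ is $x(1-x)f'(x)+[-(a+b)x+a]f(x)=\hat h(x)$ with $\hat h:=h-\nu_{a,b}(h)$. The solution $f_h:\mathbb{R}\to\mathbb{R}$ is $f_h(x)=\frac{1}{x(1-x)q_{a,b}(x)}\int_0^x\hat h(t)q_{a,b}(t)\,dt$ for $0<x<1$; $f_h(x)=\frac{1}{|x|^a(1-x)^b}\int_x^0\hat h(t)|t|^{a-1}(1-t)^{b-1}dt$ for $x<0$; $f_h(x)=-\frac{1}{x^a(x-1)^b}\int_1^x\hat h(t)t^{a-1}(t-1)^{b-1}dt$ for $x>1$; $f_h(0)=\hat h(0)/a$, $f_h(1)=-\hat h(1)/b$. $\|\cdot\|_\infty$ is the essential supremum norm (with respect to Lebesgue measure) on $\mathbb{R}$; for Lipschitz $h$, $\|h'\|_\infty$ is the minimal Lipschitz constant of $h$. *)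

(* Defs.v *)
From HB Require Import structures.
From mathcomp Require Import all_boot all_order all_algebra.
From mathcomp Require Import all_classical all_reals all_analysis.
From mathcomp Require Import measurable_realfun.

Set Implicit Arguments.
Unset Strict Implicit.
Unset Printing Implicit Defensive.

Import Order.TTheory GRing.Theory Num.Theory.
Import numFieldNormedType.Exports.

Local Open Scope ring_scope.
Local Open Scope classical_set_scope.

(* The library's beta_fun, beta_pdf and beta_prob only cover parameters that
   are natural numbers; here the parameters are real. *)

Definition euler_beta (R : realType) (a b : R) : R :=
  \int[lebesgue_measure]_(x in `]0, 1[) (x `^ (a - 1) * (1 - x) `^ (b - 1)).

Definition beta_density (R : realType) (a b x : R) : R :=
  (euler_beta a b)^-1 * (x `^ (a - 1) * (1 - x) `^ (b - 1)) * \1_(`]0, 1[) x.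

Definition beta_distr (R : realType) (a b : R)
    (A : set (measurableTypeR R)) : \bar R :=
  (\int[lebesgue_measure]_(x in A) (beta_density a b x)%:E)%E.

Section beta_distr_measure.
Context (R : realType) (a b : R).

Lemma measurable_beta_density : measurable_fun [set: R] (beta_density a b).
Proof.
apply: measurable_funM => /=; last first.
  by apply: measurable_indic; exact: measurable_itv.
apply: measurable_funM => //; apply: measurable_funM => /=.
- exact: measurable_powR.
- apply: (@measurableT_comp _ _ _ _ _ _ (@powR R ^~ _)) => /=.
    exact: measurable_powR.
  exact: measurable_funB.
Qed.

Lemma euler_beta_ge0 : 0 <= euler_beta a b.
Proof.
by apply: Rintegral_ge0 => x _; rewrite mulr_ge0 ?powR_ge0.
Qed.

Lemma beta_density_ge0 (x : R) : 0 <= beta_density a b x.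
Proof.
by rewrite !mulr_ge0 ?invr_ge0 ?euler_beta_ge0 ?powR_ge0 ?indicE.
Qed.

Let beta_distr0 : beta_distr a b set0 = 0%E.
Proof. by rewrite /beta_distr integral_set0. Qed.

Let beta_distr_ge0 A : (0 <= beta_distr a b A)%E.
Proof. by apply: integral_ge0 => x _; rewrite lee_fin beta_density_ge0. Qed.

Let beta_distr_sigma_additive : semi_sigma_additive (beta_distr a b).
Proof.
apply: semi_sigma_additive_nng_induced => [|x].
  by apply/measurable_EFinP; exact: measurable_beta_density.
by rewrite lee_fin beta_density_ge0.
Qed.

HB.instance Definition _ := isMeasure.Build _ _ _ (beta_distr a b)
  beta_distr0 beta_distr_ge0 beta_distr_sigma_additive.

End beta_distr_measure.

Definition beta_mean (R : realType) (a b : R) (h : R -> R) : R :=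
  \int[beta_distr a b]_x h x.

(* The solution f_h of
     x (1 - x) f'(x) + (a - (a + b) x) f(x) = h(x) - beta_mean a b h. *)
Definition stein_sol (R : realType) (a b : R) (h : R -> R) (x : R) : R :=
  let hh t := h t - beta_mean a b h in
  if x < 0 then
    (`|x| `^ a * (1 - x) `^ b)^-1 *
      \int[lebesgue_measure]_(t in `]x, 0[)
        (hh t * `|t| `^ (a - 1) * (1 - t) `^ (b - 1))
  else if x == 0 then hh 0 / a
  else if x < 1 then
    (x * (1 - x) * beta_density a b x)^-1 *
      \int[lebesgue_measure]_(t in `]0, x[) (hh t * beta_density a b t)
  else if x == 1 then - (hh 1 / b)
  else
    - ((x `^ a * (x - 1) `^ b)^-1 *
      \int[lebesgue_measure]_(t in `]1, x[)
        (hh t * t `^ (a - 1) * (t - 1) `^ (b - 1))).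

(* Minimal Lipschitz constant (+oo if h is not Lipschitz). *)
Definition lip_norm (R : realType) (h : R -> R) : \bar R :=
  ereal_inf [set k%:E | k in [set k : R | k.-lipschitz h]].

Definition sup_norm (R : realType) (g : R -> R) : \bar R :=
  ('N[lebesgue_measure]_+oo[EFin \o g])%E.

Definition twice_diff_bounded (R : realType) (h : R -> R) : Prop :=
  [/\ forall x : R, derivable h x 1, forall x : R, derivable h^`() x 1,
      bounded_fun h^`() & bounded_fun h^`(2)].

(* The operator f |-> f^`() is total: it takes a default value where the
   derivative does not exist. The almost-everywhere clauses say that the
   essential suprema below are those of actual derivatives. *)
Definition stein_bounds (R : realType) (a b C1 C2 : R) : Prop :=
  (forall h : R -> R, lipschitz h ->
     let f := stein_sol a b h in
     {ae lebesgue_measure, forall x : R, derivable f x 1} /\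
     (sup_norm f^`() <= C1%:E * lip_norm h)%E) /\
  (forall h : R -> R, twice_diff_bounded h ->
     let f := stein_sol a b h in
     {ae lebesgue_measure,
       forall x : R, derivable f x 1 /\ derivable f^`() x 1} /\
     (sup_norm f^`(2) <= C2%:E * (lip_norm h + sup_norm h^`(2)))%E).

(* A history of drawings is the sequence of their colours, true being red. *)
Definition urn_red (r c : nat) (s : seq bool) : nat :=
  (r + c * count id s)%N.

Definition urn_white (w c : nat) (s : seq bool) : nat :=
  (w + c * count negb s)%N.

Section urn.
Context (d : measure_display) (T : measurableType d) (R : realType).
Context (P : probability T R).

(* D j is the colour of the j-th drawn ball, j = 1, 2, ... (D 0 is unused). *)
Definition history (D : nat -> {RV P >-> bool}) (n : nat) (t : T) : seq bool :=
  [seq D j t | j <- iota 1 n].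

(* Given the first n drawings, the next ball is red with probability the
   proportion of red balls in the urn; the equation is multiplied out so as
   not to condition on a null event. *)
Definition polya_urn (r w c : nat) (D : nat -> {RV P >-> bool}) : Prop :=
  forall (n : nat) (s : n.-tuple bool),
    P [set t | history D n t = s /\ D n.+1 t] =
    (P [set t | history D n t = s] *
     ((urn_red r c s)%:R / (urn_red r c s + urn_white w c s)%:R)%:E)%E.

Definition red_draw (D : nat -> {RV P >-> bool}) (n : nat) (t : T) : R :=
  \1_[set t | D n t] t.

Definition red_count (D : nat -> {RV P >-> bool}) (n : nat) (t : T) : R :=
  \sum_(1 <= j < n.+1) red_draw D j t.

Definition red_freq (D : nat -> {RV P >-> bool}) (n : nat) (t : T) : R :=
  n%:R^-1 * red_count D n t.

End urn.

(* Main.v *)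
Require Import Defs.
From mathcomp Require Import all_boot all_order all_algebra.
From mathcomp Require Import all_classical all_reals all_analysis.
From mathcomp Require Import measurable_realfun ess_sup_inf ring lra.
Import Order.TTheory GRing.Theory Num.Theory.
Import numFieldNormedType.Exports.
Local Open Scope ring_scope.
Local Open Scope classical_set_scope.

(** Let f be the solution of the Stein equation for h. For x in [0, 1] the error
    h x - beta_mean a b h equals x (1 - x) f'(x) + (a - (a + b) x) f x, so what
    has to be bounded is the expectation of the right-hand side at the relative
    number x = k / n of red draws.

    The law of the number k of red draws among n is reversible for a birth and death
    chain with birth rate (n - k) (a + k) and death rate k (b + n - k)
    ([birth_death_balance]): the generator of this chain, applied to any
    function, has expectation 0. Applied to a primitive G of f at k / n, the
    generator is, up to Taylor remainders, the Stein operator applied to f plus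
    (a (1 - x) + b x) f'(x) / (2 n) ([birth_death_step]). The first term of the
    bound comes from this correction, with |f'| <= C1 |h'|, and the second from
    the remainders of order three of G, with |f''| <= C2 (|h'| + |h''|).

    Existence of C1. In terms of the distance y to one of the singular points 0
    and 1, each branch of the solution has the form [core_sol]: an average of
    the centred h over [0, y] against the weight t ^ (al - 1), up to factors
    that are regular at 0. The boundedness of f' amounts to the estimate
    |H y - al * core_sol y| = O(y) of [core_sol_defect]: the two terms differ by
    an average of increments of H, up to the variation of the regular factors.

    Existence of C2. Differentiating the Stein equation shows that f' solves the
    Stein equation with parameters a + 1 and b + 1 and right-hand side
    h' + (a + b) f. Uniqueness of bounded solutions ([stein_slope_next])
    identifies f' with the corresponding [stein_sol], and the bound on f'' is the
    first-order bound for the shifted parameters. This also shows that f' extends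
    to a Lipschitz function on the whole line, as the Taylor bounds at the end
    points of [0, 1] require.

    Essential suprema are turned into Lipschitz constants by
    [klipschitz_ae_derive]. *)

Set Implicit Arguments.
Unset Strict Implicit.
Unset Printing Implicit Defensive.

(** * Derivatives and mean value inequalities *)

Section derivation_rules.
Context {R : realType}.
Implicit Types (f g : R -> R) (x df dg k : R).

Lemma is_derive1_eq f x df dg : is_derive x 1 f df -> df = dg ->
  is_derive x 1 f dg.
Proof. by move=> + <-. Qed.

Lemma is_derive1D f g x df dg : is_derive x 1 f df -> is_derive x 1 g dg ->
  is_derive x 1 (fun t => f t + g t) (df + dg).
Proof. by move=> fx gx; exact: is_deriveD. Qed.

Lemma is_derive1B f g x df dg : is_derive x 1 f df -> is_derive x 1 g dg ->
  is_derive x 1 (fun t => f t - g t) (df - dg).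
Proof. by move=> fx gx; exact: is_deriveB. Qed.

Lemma is_derive1M f g x df dg : is_derive x 1 f df -> is_derive x 1 g dg ->
  is_derive x 1 (fun t => f t * g t) (df * g x + f x * dg).
Proof.
move=> fx gx; have := is_deriveM fx gx.
by rewrite /GRing.scale/= addrC (mulrC (g x)).
Qed.

Lemma is_derive1Ml k g x dg : is_derive x 1 g dg ->
  is_derive x 1 (fun t => k * g t) (k * dg).
Proof. by move=> gx; exact: is_deriveZ. Qed.

Lemma is_derive1V f x df : f x != 0 -> is_derive x 1 f df ->
  is_derive x 1 (fun t => (f t)^-1) (- df / f x ^+ 2).
Proof.
move=> fx0 fx; have := is_deriveV fx0 fx.
by rewrite /GRing.scale/= mulNr mulrC mulNr.
Qed.

Lemma is_derive1_affine k s x : is_derive x 1 (fun t => k + s * t) s.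
Proof.
have := is_derive1D (is_derive_cst k x 1)
  (is_derive1M (is_derive_cst s x 1) (is_derive_id x 1)).
by rewrite mul0r add0r add0r mulr1.
Qed.

Lemma is_derive1_affine_comp f k s x df : is_derive (k + s * x) 1 f df ->
  is_derive x 1 (fun t => f (k + s * t)) (df * s).
Proof.
move=> fx; exact: (@is_derive1_comp R f (fun t => k + s * t) x df s fx
  (is_derive1_affine k s x)).
Qed.

Lemma is_derive1_continuous f x df : is_derive x 1 f df -> {for x, continuous f}.
Proof.
by move=> [dfx _]; apply/differentiable_continuous/derivable1_diffP.
Qed.

Lemma is_derive1E f x df : is_derive x 1 f df -> f^`() x = df.
Proof. by move=> [_ <-]; rewrite derive1E. Qed.

Lemma derivable_is_derive1 f x : derivable f x 1 -> is_derive x 1 f (f^`() x).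
Proof. by move=> fx; rewrite derive1E; exact: derivableP. Qed.

Lemma is_derive1_near f g x df : (\near x, f x = g x) ->
  is_derive x 1 f df -> is_derive x 1 g df.
Proof. exact: near_eq_is_derive. Qed.

End derivation_rules.

Section lipschitz_functions.
Context {R : realType}.
Implicit Types (f g h : R -> R) (k : R).

Lemma klipschitzP f k :
  k.-lipschitz f <-> forall x y, `|f x - f y| <= k * `|x - y|.
Proof.
split=> [kf x y|kf [x y] _ /=]; last exact: kf.
exact: (kf (x, y)).
Qed.

Lemma klipschitz_ge0 f k : k.-lipschitz f -> 0 <= k.
Proof.
move=> /klipschitzP /(_ 1 0); rewrite subr0 normr1 mulr1.
exact: le_trans.
Qed.

Lemma klipschitz_continuous f k : k.-lipschitz f -> continuous f.
Proof.
move=> kf x; have k0 := klipschitz_ge0 kf.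
apply/cvgrPdist_le => e e0.
have k1 : 0 < k + 1 by rewrite ltr_wpDl.
near=> y.
rewrite (le_trans ((klipschitzP _ _).1 kf x y))//.
rewrite (@le_trans _ _ ((k + 1) * `|x - y|))//.
  by rewrite ler_wpM2r// lerDl.
rewrite mulrC -ler_pdivlMr//.
near: y; apply: cvgr_dist_le; first exact: cvg_id.
by rewrite divr_gt0.
Unshelve. all: by end_near. Qed.

(** The radius 1/2 separates the points 0 and 1, at which this is applied. *)
Lemma continuous_at_le (g : R -> R) (e C : R) :
  (forall x, `|x - e| <= 2^-1 -> `|g x - g e| <= C * `|x - e|) -> {for e, continuous g}.
Proof.
move=> gC.
have C0 : 0 <= C.
  have := gC (e + 2^-1); rewrite (addrC e) addrK ger0_norm// =>
    /(_ (lexx _)) /(le_trans (normr_ge0 _)).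
  by rewrite pmulr_lge0.
apply/cvgrPdist_le => d d0; near=> x.
have xe : `|x - e| <= 2^-1.
  by near: x; apply: cvgr_distC_le => //; exact: cvg_id.
rewrite distrC (le_trans (gC x xe))//.
rewrite (@le_trans _ _ ((C + 1) * `|x - e|))//; first by rewrite ler_wpM2r// lerDl.
rewrite mulrC -ler_pdivlMr ?ltr_wpDl//.
near: x; apply: cvgr_distC_le; first exact: cvg_id.
by rewrite divr_gt0// ltr_wpDl.
Unshelve. all: by end_near. Qed.

Lemma lipschitzP f : lipschitz f <-> exists k, k.-lipschitz f.
Proof.
split=> [[M [_ fM]]|[k kf]].
  by exists (M + 1); apply: fM; rewrite ltrDl.
rewrite /lipschitz_on; near=> M => -[x y] _ /=.
rewrite (le_trans ((klipschitzP _ _).1 kf x y))// ler_wpM2r//.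
Unshelve. all: by end_near. Qed.

(** The infimum is attained because the Lipschitz inequality passes to the limit
    in the constant. *)
Lemma lip_normP f : lipschitz f ->
  exists2 L, lip_norm f = L%:E & L.-lipschitz f.
Proof.
move=> /lipschitzP[k kf].
have lf0 : (0 <= lip_norm f)%E.
  by apply: le_ereal_inf_tmp => _ [m /= mf <-]; rewrite lee_fin; exact: klipschitz_ge0 mf.
have lfk : (lip_norm f <= k%:E)%E by apply: ge_ereal_inf; exists k%:E => //; exists k.
have fl : lip_norm f \is a fin_num.
  by rewrite ge0_fin_numE// (le_lt_trans lfk)// ltry.
exists (fine (lip_norm f)); first by rewrite fineK.
apply/klipschitzP => x y; have [->|xy] := eqVneq x y.
  by rewrite !subrr normr0 mulr0.
have xy0 : 0 < `|x - y| by rewrite normr_gt0 subr_eq0.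
rewrite -ler_pdivrMr// -lee_fin fineK//.
apply: le_ereal_inf_tmp => _ [m /= mf <-]; rewrite lee_fin ler_pdivrMr//.
exact: (klipschitzP _ _).1 mf x y.
Qed.

(** Cutting the interval at an exceptional point leaves intervals with fewer
    exceptional points, and continuity glues the resulting inequalities. *)
Lemma nonincreasing_except f (s : seq R) (x y : R) : x <= y ->
  {within `[x, y], continuous f} ->
  (forall t, t \in `]x, y[%R -> t \notin s -> derivable f t 1 /\ f^`() t <= 0) ->
  f y <= f x.
Proof.
elim: s x y => [|p s IHs] x y xy cf df.
  move: xy; rewrite le_eqVlt => /predU1P[->//|xy].
  have [|c cxy] := @MVT R f f^`() x y xy _ cf.
    by move=> t txy; have [//|dt _] := df t txy; rewrite derive1E; exact: derivableP.
  have [_ fc] := df c cxy isT.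
  by rewrite -subr_le0 => ->; rewrite mulr_le0_ge0// subr_ge0 ltW.
have [/andP[xp py]|pxy] := boolP (x <= p <= y).
  apply: (@le_trans _ _ (f p)).
  - apply: IHs => // [|t].
      by apply: continuous_subspaceW cf; apply: subset_itvr; rewrite bnd_simp.
    rewrite in_itv/= => /andP[pt ty] ts.
    apply: df; first by rewrite in_itv/= ty (le_lt_trans xp pt).
    by rewrite inE negb_or ts andbT gt_eqF.
  - apply: IHs => // [|t].
      by apply: continuous_subspaceW cf; apply: subset_itvl; rewrite bnd_simp.
    rewrite in_itv/= => /andP[xt tp] ts.
    apply: df; first by rewrite in_itv/= xt (lt_le_trans tp py).
    by rewrite inE negb_or ts andbT lt_eqF.
apply: IHs => // t txy ts; apply: df => //.
rewrite inE negb_or ts andbT; apply: contraNneq pxy => <-.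
by move: txy; rewrite in_itv/= => /andP[/ltW-> /ltW->].
Qed.

(** Both [f - m] and [- f - m] are nonincreasing. A general majorant [m] makes
    this usable for Taylor remainders as well as for Lipschitz constants. *)
Lemma mean_value_majorant f m dm (s : seq R) (x y : R) : x <= y ->
  {within `[x, y], continuous f} -> (forall t : R, is_derive t 1 m (dm t)) ->
  (forall t, t \in `]x, y[%R -> t \notin s ->
    derivable f t 1 /\ `|f^`() t| <= dm t) ->
  `|f y - f x| <= m y - m x.
Proof.
move=> xy cf dmE df.
have cm : {within `[x, y], continuous m}.
  by apply: continuous_subspaceT => t; exact: is_derive1_continuous (dmE t).
have fm : f y - m y <= f x - m x.
  apply: (@nonincreasing_except (fun t => f t - m t) s) => // [|t txy ts].
    by move=> t; apply: cvgB; [exact: cf|exact: cm].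
  have [dft ft] := df t txy ts.
  have D := is_derive1B (derivable_is_derive1 dft) (dmE t).
  split; first by case: D.
  by rewrite (is_derive1E D) subr_le0; exact: le_trans (ler_norm _) ft.
have fm' : - f y - m y <= - f x - m x.
  apply: (@nonincreasing_except (fun t => - f t - m t) s) => // [|t txy ts].
    by move=> t; apply: cvgB; [apply: cvgN; exact: cf|exact: cm].
  have [dft ft] := df t txy ts.
  have D := is_derive1B (is_deriveN (derivable_is_derive1 dft)) (dmE t).
  split; first by case: D.
  rewrite (is_derive1E D) subr_le0; apply: le_trans ft.
  by rewrite -normrN ler_norm.
rewrite ler_norml; apply/andP; split; lra.
Qed.

Lemma klipschitz_derive_except f k (s : seq R) : continuous f ->
  (forall t, t \notin s -> derivable f t 1 /\ `|f^`() t| <= k) ->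
  k.-lipschitz f.
Proof.
move=> cf df; apply/klipschitzP => x y.
wlog xy : x y / x <= y.
  by move=> wl; case: (leP x y) => [/wl//|/ltW/wl]; rewrite distrC (distrC y).
rewrite distrC (distrC x) (@ger0_norm _ (y - x)) ?subr_ge0// mulrBr.
have dk (t : R) : is_derive t 1 (k \*: @id R) k.
  by have := is_deriveZ k (is_derive_id t (1 : R)); rewrite /GRing.scale/= mulr1.
apply: (@mean_value_majorant f _ _ s _ _ xy _ dk) => [|t _]; last exact: df.
exact: continuous_subspaceT.
Qed.

Lemma klipschitz_derivable f k x : k.-lipschitz f -> derivable f x 1 ->
  `|f^`() x| <= k.
Proof.
move=> /klipschitzP kf dfx; rewrite derive1E.
have : (fun e : R => `|e^-1 *: (f (e *: 1 + x) - f x)|) @ 0^' --> `|'D_1 f x|.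
  by apply: cvg_norm; exact: dfx.
move=> /cvgr_to_le; apply; near=> e.
have e0 : e != 0 by near: e; exact: nbhs_dnbhs_neq.
rewrite normrZ normfV ler_pdivrMl ?normr_gt0// mulrC.
by rewrite (le_trans (kf _ _))// addrK /GRing.scale/= mulr1.
Unshelve. all: by end_near. Qed.

End lipschitz_functions.

(** * Almost everywhere bounds *)

Section sup_norm.
Context {R : realType}.
Implicit Types (g : R -> R) (C : R).
Notation mu := (@lebesgue_measure R).

Lemma ae_imply (P Q : R -> Prop) : (forall x, P x -> Q x) ->
  {ae mu, forall x, P x} -> {ae mu, forall x, Q x}.
Proof. by move=> PQ; exact: (@filterS _ _ (ae_filter_ringOfSetsType mu)). Qed.

Lemma ae_conj (P Q : R -> Prop) :
  {ae mu, forall x, P x} -> {ae mu, forall x, Q x} ->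
  {ae mu, forall x, P x /\ Q x}.
Proof.
by apply: (@filterS2 _ _ (ae_filter_ringOfSetsType mu)) => x Px Qx; split.
Qed.

Lemma lebesgue_measureT_gt0 : (0 < mu setT)%E.
Proof.
rewrite (@lt_le_trans _ _ (mu `[0, 1]))//.
  by rewrite lebesgue_measure_itv/= lte_fin ltr01 oppr0 adde0 lte_fin.
by apply: le_measure; rewrite ?inE//; exact: measurable_itv.
Qed.

Lemma sup_normP g C :
  (sup_norm g <= C%:E)%E <-> {ae mu, forall x, `|g x| <= C}.
Proof.
rewrite /sup_norm unlock lebesgue_measureT_gt0.
split=> [/ess_supP|gC].
  by apply: ae_imply => x /=; rewrite lee_fin.
by apply/ess_supP; apply: ae_imply gC => x /=; rewrite lee_fin.
Qed.

Lemma sup_norm_ge0 g : (0 <= sup_norm g)%E.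
Proof. exact: Lnorm_ge0. Qed.

Lemma sup_norm_fin g C : (forall x, `|g x| <= C) ->
  exists2 N, sup_norm g = N%:E & 0 <= N.
Proof.
move=> gC; have : (sup_norm g <= C%:E)%E by apply/sup_normP; apply: aeW => x; exact: gC.
have := sup_norm_ge0 g; case: (sup_norm g) => [N|//|//] N0 _.
by exists N.
Qed.

Lemma ae_notin (s : seq R) : {ae mu, forall x, x \notin s}.
Proof.
elim: s => [|p s IHs]; first exact: aeW.
have : {ae mu, forall x, x != p}.
  exists [set p]; split; [exact: measurable_set1|exact: lebesgue_measure_set1|].
  by move=> x /= /negP; rewrite negbK => /eqP.
by move=> /(ae_conj IHs); apply: ae_imply => x [xs xp]; rewrite inE negb_or xp.
Qed.

End sup_norm.

Section lipschitz_ae.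
Context {R : realType}.
Notation mu := (@lebesgue_measure R).
Implicit Types g : R -> R.

Lemma continuous_primitive g (a b : R) : continuous g ->
  exists G : R -> R, forall x, x \in `]a, b[%R -> is_derive x 1 G (g x).
Proof.
move=> cg; exists (fun u => \int[mu]_(t in `[a, u]) g t) => x.
rewrite in_itv/= => /andP[ax xb].
have [dG G'] := @continuous_FTC1_closed R g a x b xb
  (continuous_compact_integrable (@segment_compact _ a b)
    (continuous_subspaceT cg)) ax (cg x).
by split; [exact: dG|rewrite -derive1E; exact: G'].
Qed.

Lemma derive1_cvg_harmonic g (x : R) : derivable g x 1 ->
  (harmonic n)^-1 * (g (x + harmonic n) - g x) @[n --> \oo] --> g^`() x.
Proof.
move=> dg; rewrite derive1E.
pose k (h : R) := h^-1 *: (g (h *: 1 + x) - g x).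
have -> : (fun n => (harmonic n)^-1 * (g (x + harmonic n) - g x)) =
    (fun n => k (harmonic n)).
  by apply/funext => n; rewrite /k /GRing.scale/= mulr1 (addrC x).
have /cvgr_dnbhsP : k h @[h --> 0^'] --> 'D_1 g x by exact: dg.
apply; split; last exact: cvg_harmonic.
by move=> n; rewrite gt_eqF// harmonic_gt0.
Qed.

(** The difference quotients of [g] are dominated by [M], so they may be
    integrated in the limit, and their integral over [x, y] tends to [g y - g x]
    because they are derivatives of difference quotients of a primitive of [g].
    Replacing their absolute values by the maximum with [N] makes the limit of
    the integrands the constant [N] almost everywhere, which avoids any question
    about the measurability of the derivative of [g]. *)
Lemma klipschitz_ae_derive g (M N : R) : M.-lipschitz g ->
  {ae mu, forall x, derivable g x 1 /\ `|g^`() x| <= N} ->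
  N.-lipschitz g.
Proof.
move=> gM gN; have cg := klipschitz_continuous gM.
apply/klipschitzP => x y; wlog xy : x y / x < y.
  move=> wl; case: (ltgtP x y) => [/wl//|/wl|->]; first by rewrite distrC (distrC y).
  by rewrite !subrr normr0 mulr0.
rewrite distrC (distrC x) (@ger0_norm _ (y - x)) ?subr_ge0 ?(ltW xy)//.
have [G dG] := @continuous_primitive g (x - 1) (y + 2) cg.
pose q (n : nat) (t : R) := (harmonic n)^-1 * (g (t + harmonic n) - g t).
pose Q (n : nat) (t : R) := (harmonic n)^-1 * (G (t + harmonic n) - G t).
have h0 n : 0 < harmonic n :> R by exact: harmonic_gt0.
have h1 n : harmonic n <= 1 :> R by rewrite /harmonic/= invf_le1// ler1n.
have cq n : continuous (q n).
  move=> t; apply: cvgM; first exact: cvg_cst.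
  apply: cvgB; last exact: cg.
  apply: (@cvg_comp _ _ _ (fun t => t + harmonic n) g _ (nbhs (t + harmonic n))); last exact: cg.
  by apply: cvgD; [exact: cvg_id|exact: cvg_cst].
have dQ n t : t \in `[x, y]%R -> is_derive t 1 (Q n) (q n t).
  rewrite in_itv/= => /andP[xt ty]; rewrite /Q /q.
  move: (harmonic n) (h0 n) (h1 n) => e e0 e1.
  apply: is_derive1Ml; apply: is_derive1B; last first.
    by apply: dG; rewrite in_itv/=; apply/andP; split; lra.
  have : is_derive (e + 1 * t) 1 G (g (t + e)).
    rewrite mul1r addrC; apply: dG; rewrite in_itv/=; apply/andP; split; lra.
  move=> /is_derive1_affine_comp; rewrite mulr1.
  by under eq_fun do rewrite mul1r addrC.
have intq n : (\int[mu]_(t in `[x, y]) (q n t)%:E = (Q n y)%:E - (Q n x)%:E)%E.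
  apply: continuous_FTC2 => //.
  - exact: continuous_subspaceT.
  - split.
    + by move=> t txy; have [] := dQ n t (subset_itv_oo_cc txy).
    + apply: cvg_at_right_filter; apply: (is_derive1_continuous (dQ n x _)).
      by rewrite in_itv/= lexx ltW.
    + apply: cvg_at_left_filter; apply: (is_derive1_continuous (dQ n y _)).
      by rewrite in_itv/= lexx ltW.
  - by move=> t txy; exact/is_derive1E/dQ/subset_itv_oo_cc.
pose m (n : nat) (t : R) := Num.max `|q n t| N.
have cm n : continuous (m n).
  move=> t; apply: (@continuous_max _ _ (fun t => `|q n t|) (cst N)).
    by apply: cvg_norm; exact: cq.
  exact: cvg_cst.
have intq' n : mu.-integrable `[x, y] (EFin \o q n).
  exact: continuous_compact_integrable (@segment_compact _ x y) (continuous_subspaceT (cq n)).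
have intm n : mu.-integrable `[x, y] (EFin \o m n).
  exact: continuous_compact_integrable (@segment_compact _ x y) (continuous_subspaceT (cm n)).
have intnq n : mu.-integrable `[x, y] (EFin \o (fun t => `|q n t|)).
  apply: continuous_compact_integrable (@segment_compact _ x y) (continuous_subspaceT _).
  by move=> t; apply: cvg_norm; exact: cq.
have le_m n : `|Q n y - Q n x| <= \int[mu]_(t in `[x, y]) m n t.
  rewrite (_ : Q n y - Q n x = \int[mu]_(t in `[x, y]) q n t); last first.
    by rewrite /Rintegral intq.
  apply: le_trans.
    by apply: le_normr_Rintegral; [exact: measurable_itv|exact: intq'].
  apply: le_Rintegral => //.
  by move=> t _; rewrite /m le_max lexx.
have m_cvg : \int[mu]_(t in `[x, y]) m n t @[n --> \oo] --> N * (y - x).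
  have [|||||_ _] := @dominated_convergence _ (measurableTypeR R) R mu `[x, y]
    (measurable_itv _) (fun n => EFin \o m n) (cst N%:E) (cst (Num.max M N)%:E).
  - by move=> n; exact: measurable_int (intm n).
  - exact: measurable_cst.
  - apply: ae_imply gN => t [dt tN] _.
    apply: cvg_EFin; first exact: nearW.
    have qt : `|q n t| @[n --> \oo] --> `|g^`() t|.
      by apply: cvg_norm; exact: derive1_cvg_harmonic.
    have cmax : {for `|g^`() t|, continuous (fun z : R => Num.max z N)}.
      by apply: (@continuous_max _ _ id (cst N)); [exact: cvg_id|exact: cvg_cst].
    rewrite /= -[in X in _ --> X](max_r tN).
    exact: (@cvg_comp _ _ _ (fun n => `|q n t|) (fun z : R => Num.max z N) _ _ _ qt cmax).
  - apply: continuous_compact_integrable (@segment_compact _ x y) (continuous_subspaceT _).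
    exact: cst_continuous.
  - apply: aeW => t n _ /=; rewrite lee_fin ger0_norm; last by rewrite le_max normr_ge0.
    rewrite ge_max !le_max lexx orbT andbT; apply/orP; left.
    rewrite /q normrM normfV (gtr0_norm (h0 n)) ler_pdivrMl// mulrC.
    by rewrite (le_trans ((klipschitzP _ _).1 gM _ _))// (addrC t) addrK gtr0_norm.
  rewrite integral_cst//= lebesgue_measure_itv/= lte_fin xy -EFinB -EFinM.
  by move=> /fine_cvg.
have Q_cvg t : t \in `[x, y]%R -> Q n t @[n --> \oo] --> g t.
  move=> txy; have dGt : is_derive t 1 G (g t).
    by apply: dG; move: txy; rewrite !in_itv/= => /andP[? ?]; apply/andP; split; lra.
  by rewrite -(is_derive1E dGt); apply: derive1_cvg_harmonic; case: dGt.
have Qxy : `|Q n y - Q n x| @[n --> \oo] --> `|g y - g x|.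
  by apply: cvg_norm; apply: cvgB; apply: Q_cvg; rewrite in_itv/= lexx ltW.
by apply: ler_cvg_to Qxy m_cvg _; apply: nearW.
Qed.

End lipschitz_ae.

(** * Integrals against a power weight *)

Section power_integrals.
Context {R : realType}.
Notation mu := (@lebesgue_measure R).
Implicit Types (a y C : R) (psi : R -> R).

Lemma powR_continuous a (x : R) : 0 < x -> {for x, continuous (fun t : R => t `^ a)}.
Proof. by move=> x0; exact: is_derive1_continuous (is_derive1_powR a x0). Qed.

Lemma is_derive1_powR_div a (x : R) : 0 < a -> 0 < x ->
  is_derive x 1 (fun t : R => t `^ a / a) (x `^ (a - 1)).
Proof.
move=> a0 x0.
have := is_derive1Ml a^-1 (is_derive1_powR a x0).
rewrite mulrA mulVf ?gt_eqF// mul1r.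
by under eq_fun do rewrite mulrC.
Qed.

Lemma integral_powR_cc a c y : 0 < a -> 0 < c -> c < y ->
  (\int[mu]_(t in `[c, y]) (t `^ (a - 1))%:E = (y `^ a / a)%:E - (c `^ a / a)%:E)%E.
Proof.
move=> a0 c0 cy; apply: (@continuous_FTC2 R (fun t => t `^ (a - 1)) (fun t => t `^ a / a)) => //.
- apply: continuous_in_subspaceT => t; rewrite inE/= in_itv/= => /andP[ct _].
  exact/powR_continuous/(lt_le_trans c0).
- split.
  + move=> t; rewrite in_itv/= => /andP[ct _].
    by have [] := is_derive1_powR_div a0 (lt_trans c0 ct).
  + apply: cvg_at_right_filter.
    exact: is_derive1_continuous (is_derive1_powR_div a0 c0).
  + apply: cvg_at_left_filter.
    exact: is_derive1_continuous (is_derive1_powR_div a0 (lt_trans c0 cy)).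
- move=> t; rewrite in_itv/= => /andP[ct _].
  exact/is_derive1E/is_derive1_powR_div/(lt_trans c0).
Qed.

Lemma measurable_powR_EFin a (D : set R) :
  measurable_fun D (fun t : R => (t `^ a)%:E).
Proof. by apply/measurable_EFinP; apply: measurable_funTS; exact: measurable_powR. Qed.

(** The integrand is unbounded at 0 when [a < 1], hence the monotone convergence
    over the intervals [[y / (n + 2), y]]. *)
Lemma integral_powR a y : 0 < a -> 0 < y ->
  (\int[mu]_(t in `]0%R, y[) (t `^ (a - 1))%:E = (y `^ a / a)%:E)%E.
Proof.
move=> a0 y0; rewrite integral_itv_bndo_bndc; last exact: measurable_powR_EFin.
pose c (n : nat) : R := y * (n.+2%:R)^-1.
have c0 n : 0 < c n by rewrite mulr_gt0 ?invr_gt0.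
have cy n : c n < y by rewrite ltr_pdivrMr// ltr_pMr// ltr1n.
have c_cvg : c n @[n --> \oo] --> 0.
  rewrite -(mulr0 y); apply: cvgMr.
  by have := @cvg_harmonic R; rewrite -(cvg_shiftn 1)/=; under eq_fun do rewrite addn1.
have -> : `]0, y]%classic = \bigcup_n `[c n, y]%classic.
  apply/seteqP; split => t /=.
    rewrite in_itv/= => /andP[t0 ty].
    have /cvgr_lt/(_ t t0) [n _ /(_ n (leqnn n)) cnt] := c_cvg.
    by exists n => //=; rewrite in_itv/= ty andbT ltW.
  by move=> [n _] /=; rewrite !in_itv/= => /andP[ct ->]; rewrite (lt_le_trans (c0 n)).
pose f (t : R) : \bar R := (t `^ (a - 1))%:E.
have F_cvg : (\int[mu]_(t in `[c n, y]) f t)%E @[n --> \oo] -->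
    (\int[mu]_(t in \bigcup_n `[c n, y]%classic) f t)%E.
  apply: (@ge0_nondecreasing_set_cvg_integral _ (measurableTypeR R) R (fun n => `[c n, y]%classic) f mu).
  - move=> m n mn; apply/subsetPset => t /=; rewrite !in_itv/= => /andP[ct ->].
    by rewrite andbT (le_trans _ ct)// /c ler_pM2l// lef_pV2 ?posrE// ler_nat.
  - by move=> n; exact: measurable_itv.
  - by move=> n; exact: measurable_powR_EFin.
  - by move=> n t _; rewrite lee_fin powR_ge0.
apply: (cvg_unique _ F_cvg) => //.
rewrite (_ : (fun n => _) = (fun n => (y `^ a / a - c n `^ a / a)%:E)); last first.
  by apply/funext => n; rewrite EFinB -integral_powR_cc.
apply: cvg_EFin; first exact: nearW.
rewrite /comp/= -[X in _ --> X]subr0 -(mul0r a^-1); apply: cvgB; first exact: cvg_cst.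
apply: cvgMl; have /cvg_at_rightP := powR_cvg0 a0; apply; split => //.
Qed.

Lemma integrable_powR a y : 0 < a -> 0 < y ->
  mu.-integrable `]0, y[ (fun t : R => (t `^ (a - 1))%:E).
Proof.
move=> a0 y0; apply/integrableP; split; first exact: measurable_powR_EFin.
under eq_integral do rewrite gee0_abs ?lee_fin ?powR_ge0//.
by rewrite integral_powR// ltry.
Qed.

Section weighted.
Variables (a y C : R) (psi : R -> R).
Hypotheses (a0 : 0 < a) (y0 : 0 < y) (mpsi : measurable_fun [set: R] psi).
Hypothesis psiC : forall t, 0 < t -> t < y -> `|psi t| <= C.

Let mf (D : set R) : measurable_fun D (fun t : R => (t `^ (a - 1) * psi t)%:E).
Proof.
apply/measurable_EFinP; apply: measurable_funTS; exact: measurable_funM.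
Qed.

Lemma integrable_powRM :
  mu.-integrable `]0, y[ (fun t : R => (t `^ (a - 1) * psi t)%:E).
Proof.
apply: (@le_integrable _ _ _ mu _ (measurable_itv _) _ (fun t : R => (C * t `^ (a - 1))%:E)).
- exact: mf.
- move=> t /=; rewrite in_itv/= => /andP[t0 ty].
  rewrite lee_fin !normrM mulrC ler_wpM2r// (le_trans (psiC t0 ty))// ler_norm//.
- under [X in integrable _ _ X]eq_fun do rewrite EFinM.
  by apply: integrableZl; [exact: measurable_itv|exact: integrable_powR].
Qed.

Lemma Rintegral_powRM_le :
  `|\int[mu]_(t in `]0, y[) (t `^ (a - 1) * psi t)| <= C * (y `^ a / a).
Proof.
apply: le_trans.
  by apply: le_normr_Rintegral; [exact: measurable_itv|exact: integrable_powRM].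
have intC : mu.-integrable `]0, y[ (fun t : R => (t `^ (a - 1))%:E) by exact: integrable_powR.
rewrite (_ : C * _ = \int[mu]_(t in `]0, y[) (C * t `^ (a - 1))); last first.
  by rewrite RintegralZl//; congr (_ * _); rewrite /Rintegral integral_powR.
apply: le_Rintegral => //.
- by have := integrable_norm integrable_powRM.
- rewrite /comp; under [X in integrable _ _ X]eq_fun do rewrite EFinM.
  by apply: integrableZl; [exact: measurable_itv|].
- move=> t; rewrite /= in_itv/= => /andP[t0 ty].
  by rewrite normrM ger0_norm ?powR_ge0// mulrC ler_wpM2r ?powR_ge0// psiC.
Qed.

Lemma is_derive1_Rintegral_powRM x : 0 < x -> x < y -> {for x, continuous psi} ->
  is_derive x 1 (fun u => \int[mu]_(t in `]0, u[) (t `^ (a - 1) * psi t))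
    (x `^ (a - 1) * psi x).
Proof.
move=> x0 xy psix.
have -> : (fun u => \int[mu]_(t in `]0, u[) (t `^ (a - 1) * psi t)) =
    (fun u => \int[mu]_(t in `]0, u]) (t `^ (a - 1) * psi t)).
  by apply/funext => u; rewrite /Rintegral integral_itv_bndo_bndc.
have [||||dF F'] := @continuous_FTC1 R (fun t => t `^ (a - 1) * psi t) (BRight 0) x ((x + y) / 2).
- lra.
- apply: integrableS integrable_powRM => //.
  by apply: subset_itvl; rewrite bnd_simp; lra.
- exact: x0.
- by apply: cvgM; [exact: powR_continuous|exact: psix].
- by split; [exact: dF|rewrite -derive1E; exact: F'].
Qed.

End weighted.

End power_integrals.

(** * Bounds on powers *)

Section powR_bounds.
Context {R : realType}.
Implicit Types u v p q m M s b : R.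

Lemma le_powRl s u v : 0 <= s -> 0 <= u -> u <= v -> u `^ s <= v `^ s.
Proof.
by move=> s0 u0 uv; apply: ge0_ler_powR; rewrite ?nnegrE// (le_trans u0).
Qed.

Lemma ge_powRl s u v : s <= 0 -> 0 < u -> u <= v -> v `^ s <= u `^ s.
Proof.
move=> s0 u0 uv; have v0 : 0 < v by exact: lt_le_trans uv.
rewrite -(opprK s) !(powRN _ (- s)) lef_pV2 ?posrE ?powR_gt0//.
by apply: le_powRl => //; [rewrite oppr_ge0|exact: ltW].
Qed.

Lemma powR_le_sum v m M s : 0 < m -> m <= v -> v <= M ->
  v `^ s <= m `^ s + M `^ s.
Proof.
move=> m0 mv vM; have v0 : 0 < v by exact: lt_le_trans mv.
have [s0|s0] := leP 0 s.
  rewrite (@le_trans _ _ (M `^ s))//; last by rewrite lerDr powR_ge0.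
  by apply: le_powRl => //; exact: ltW.
rewrite (@le_trans _ _ (m `^ s))//; last by rewrite lerDl powR_ge0.
by apply: ge_powRl => //; exact: ltW.
Qed.

Lemma powR_near1 v s : 2^-1 <= v -> v <= 2 -> v `^ s <= 2 `^ `|s|.
Proof.
move=> v1 v2; have v0 : 0 < v by lra.
have [s0|s0] := leP 0 s.
  by rewrite ger0_norm//; apply: le_powRl => //; exact: ltW.
apply: le_trans; first by apply: ge_powRl v1; [exact: ltW|rewrite invr_gt0].
rewrite ltr0_norm//.
by rewrite -(@powR_inv1 _ 2)// -powRrM mulN1r.
Qed.

Lemma powR_dist b p q : 0 < b -> 2^-1 <= p -> p <= 2 -> 2^-1 <= q -> q <= 2 ->
  `|p `^ b - q `^ b| <= b * 2 `^ (b + 1) * `|p - q|.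
Proof.
move=> b0; wlog pq : p q / p <= q.
  move=> wl p1 p2 q1 q2; have [pq|/ltW qp] := leP p q; first exact: wl.
  by rewrite distrC (distrC p); exact: wl.
move=> p1 p2 q1 q2.
have [||c] := @MVT_segment R (fun t => t `^ b) (fun t => b * t `^ (b - 1)) p q pq.
- move=> t; rewrite in_itv/= => /andP[pt _]; apply: is_derive1_powR; lra.
- apply: continuous_in_subspaceT => t; rewrite inE/= in_itv/= => /andP[pt _].
  by apply: powR_continuous; lra.
rewrite in_itv/= => /andP[pc cq] E.
rewrite distrC E (distrC p) normrM ler_wpM2r// ger0_norm ?mulr_ge0 ?powR_ge0 ?(ltW b0)//.
rewrite ler_pM2l//; apply: le_trans (@powR_near1 c _ _ _) _; [lra|lra|].
apply: ler_powR; first by rewrite ler1n.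
by rewrite ler_norml; apply/andP; split; lra.
Qed.

End powR_bounds.

(** * The Stein solution in terms of the distance to a singular point *)

Section core.
Context {R : realType}.
Notation mu := (@lebesgue_measure R).
Variables (al be s L : R) (H : R -> R).

(** Up to normalisation, the Beta weight at distance [t] from one of its singular
    points 0 and 1 is [t ^ (al - 1) * (1 + s t) ^ (be - 1)], with [s = -1] towards
    the other singular point and [s = 1] away from it. Each branch of the Stein
    solution is [core_sol] up to sign, [H] being the centred test function. *)
Definition core_sol (y : R) : R :=
  (y `^ al * (1 + s * y) `^ be)^-1 *
  \int[mu]_(t in `]0, y[) (t `^ (al - 1) * (H t * (1 + s * t) `^ (be - 1))).

Hypotheses (al0 : 0 < al) (be0 : 0 < be) (sE : s = 1 \/ s = -1).
Hypotheses (HL : L.-lipschitz H) (H0L : `|H 0| <= L).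

Let psi t := H t * (1 + s * t) `^ (be - 1).

Let L0 : 0 <= L. Proof. exact: klipschitz_ge0 HL. Qed.

Let H_le t : 0 <= t -> `|H t| <= L * (1 + t).
Proof.
move=> t0; rewrite (_ : H t = H 0 + (H t - H 0)); last by ring.
rewrite (le_trans (ler_normD _ _))// mulrDr mulr1 lerD//.
by have /klipschitzP/(_ t 0) := HL; rewrite subr0 (ger0_norm t0).
Qed.

Let mpsi : measurable_fun [set: R] psi.
Proof.
apply: measurable_funM.
  by apply: continuous_measurable_fun; exact: klipschitz_continuous HL.
apply: (@measurableT_comp _ _ _ _ _ _ (fun v : R => v `^ (be - 1))).
  exact: measurable_powR.
by apply: measurable_funD => //; exact: measurable_funM.
Qed.

Let pos_between y t : 0 < 1 + s * y -> 0 < t -> t < y -> 0 < 1 + s * t.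
Proof. by case: sE => ->; lra. Qed.

Let psi_bounded y : 0 < y -> 0 < 1 + s * y ->
  exists C, forall t, 0 < t -> t < y -> `|psi t| <= C.
Proof.
move=> y0 sy.
pose m := Num.min 1 (1 + s * y); pose M := Num.max 1 (1 + s * y).
exists (L * (1 + y) * (m `^ (be - 1) + M `^ (be - 1))) => t t0 ty.
rewrite normrM ler_pM//.
  by rewrite (le_trans (H_le (ltW t0)))// ler_wpM2l// lerD2l ltW.
rewrite ger0_norm ?powR_ge0//; apply: powR_le_sum.
- by rewrite lt_min ltr01.
- by rewrite ge_min; case: sE ty t0 => -> ty t0; apply/orP; [left|right]; lra.
- by rewrite le_max; case: sE ty t0 => -> ty t0; apply/orP; [right|left]; lra.
Qed.

(** The prefactor of the integral is the inverse of an integrating factor, so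
    this is the Stein equation in the variable [y], solved for the derivative. *)
Lemma is_derive1_core_sol y : 0 < y -> 0 < 1 + s * y ->
  is_derive y 1 core_sol
    ((H y - (al + s * (al + be) * y) * core_sol y) / (y * (1 + s * y))).
Proof.
move=> y0 sy.
have ya0 : 0 < y `^ al by rewrite powR_gt0.
have sb0 : 0 < (1 + s * y) `^ be by rewrite powR_gt0.
pose I u := \int[mu]_(t in `]0, u[) (t `^ (al - 1) * psi t).
have dI : is_derive y 1 I (y `^ (al - 1) * psi y).
  (* a point beyond [y] at which [1 + s * y'] is still positive *)
  pose y' := y + (1 + s * y) / 2.
  have y'0 : 0 < y' by rewrite /y'; lra.
  have sy' : 0 < 1 + s * y' by rewrite /y'; case: sE sy => ->; lra.
  have [C psiC] := psi_bounded y'0 sy'.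
  apply: (is_derive1_Rintegral_powRM al0 y'0 mpsi psiC) => //; first by rewrite /y'; lra.
  apply: cvgM; first exact: klipschitz_continuous HL y.
  exact: is_derive1_continuous (is_derive1_affine_comp (is_derive1_powR (be - 1) sy)).
have dW : is_derive y 1 (fun u => u `^ al * (1 + s * u) `^ be)
    (al * y `^ (al - 1) * (1 + s * y) `^ be +
     y `^ al * (be * (1 + s * y) `^ (be - 1) * s)).
  apply: is_derive1M; first exact: is_derive1_powR.
  apply: (@is_derive1_affine_comp R (fun t => t `^ be)).
  exact: is_derive1_powR.
have W0 : y `^ al * (1 + s * y) `^ be != 0 by rewrite mulf_neq0 ?gt_eqF.
have := is_derive1M (@is_derive1V R (fun u => u `^ al * (1 + s * u) `^ be) y _ W0 dW) dI.
move=> /is_derive1_eq; apply.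
rewrite /core_sol -/(psi _) -/(I y) /psi.
have -> : y `^ (al - 1) = y `^ al / y.
  by rewrite powRB ?powRr1 ?(ltW y0)// (gt_eqF y0) implybT.
have -> : (1 + s * y) `^ (be - 1) = (1 + s * y) `^ be / (1 + s * y).
  by rewrite powRB ?powRr1 ?(ltW sy)// (gt_eqF sy) implybT.
move: (y `^ al) ((1 + s * y) `^ be) (I y) ya0 sb0 => A B J A0 B0.
field.
by rewrite !gt_eqF.
Qed.

Let core_le K y : 0 < y -> 0 < 1 + s * y ->
  (forall t, 0 < t -> t < y -> `|psi t| <= K * (1 + s * y) `^ be) ->
  `|core_sol y| <= K / al.
Proof.
move=> y0 sy psiK.
have W0 : 0 < y `^ al * (1 + s * y) `^ be by rewrite mulr_gt0 ?powR_gt0.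
rewrite /core_sol normrM normfV (gtr0_norm W0) ler_pdivrMl//.
apply: le_trans (Rintegral_powRM_le al0 y0 mpsi psiK) _.
by rewrite le_eqVlt; apply/orP; left; apply/eqP; ring.
Qed.

Let s_norm : `|s| = 1.
Proof. by case: sE => ->; rewrite ?normrN normr1. Qed.

Let c : R := 2 `^ be.

Let c1 : 1 <= c.
Proof. by rewrite -(powRr0 2); apply: ler_powR; [lra|exact: ltW]. Qed.

Let le_near1 y : 0 < y -> y <= 2^-1 -> 2^-1 <= 1 + s * y /\ 1 + s * y <= 2.
Proof. by case: sE => ->; lra. Qed.

Let c_le p : 2^-1 <= p -> c^-1 <= p `^ be.
Proof.
move=> p1; rewrite -powRN -mulN1r powRrM powR_inv1//.
by apply: le_powRl => //; exact: ltW.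
Qed.

(** For [s = 1] the linear growth of [H] is absorbed by the weight, so that the
    bound holds at all distances. For [s = -1] the prefactor blows up at [y = 1],
    and the bound is only claimed on the half of [0, 1] next to the singular
    point. *)
Lemma core_sol_le y : 0 < y -> y <= 2^-1 \/ s = 1 ->
  `|core_sol y| <= 4 * c * L / al.
Proof.
have [a_gt0 b_gt0 L_ge0 c_ge1] := And4 al0 be0 L0 c1.
move=> y0 ys; have sy : 0 < 1 + s * y.
  by case: ys sE => [y2 [->|->]|-> _]; lra.
apply: core_le => // t t0 ty; rewrite normrM (ger0_norm (powR_ge0 _ (be - 1))).
have tb : (1 + s * t) `^ (be - 1) = (1 + s * t) `^ be / (1 + s * t).
  have st := pos_between sy t0 ty.
  by rewrite powRB ?powRr1 ?(ltW st)// (gt_eqF st) implybT.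
have Ht := H_le (ltW t0).
have [s1|s1] := sE.
  rewrite tb s1 !mul1r.
  have B : (1 + t) `^ be <= (1 + y) `^ be by apply: le_powRl; lra.
  have B0 : 0 <= (1 + t) `^ be by exact: powR_ge0.
  rewrite (@le_trans _ _ (L * (1 + t) * ((1 + t) `^ be / (1 + t))))//.
    by rewrite ler_wpM2r// divr_ge0//; lra.
  rewrite (_ : L * (1 + t) * _ = L * (1 + t) `^ be); last by field; lra.
  rewrite ler_pM// ler_peMl//; lra.
case: ys => [y2|]; last by rewrite s1; lra.
have A1 : (1 + s * t) `^ (be - 1) <= 2.
  rewrite tb s1 ler_pdivrMr; last by lra.
  rewrite (@le_trans _ _ 1)//; last by lra.
  by have := @le_powRl R be (1 + -1 * t) 1; rewrite powR1; apply; lra.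
rewrite (@le_trans _ _ (L * 2 * 2))//.
  rewrite ler_pM ?powR_ge0//; apply: (le_trans Ht).
  by rewrite ler_wpM2l//; lra.
rewrite (_ : L * 2 * 2 = 4 * c * L * c^-1); last by field; lra.
rewrite ler_wpM2l ?mulr_ge0//; first lra.
by apply: c_le; rewrite s1; lra.
Qed.

(** [H y] is its own average against [t ^ (al - 1)] over [0, y]. The defect is
    thus an average of differences, each of them small because [H] is Lipschitz
    and the remaining factor [(1 + s t) ^ (be - 1) / (1 + s y) ^ be] is close to
    1. *)
Lemma core_sol_defect y : 0 < y -> y <= 2^-1 ->
  `|H y - al * core_sol y| <= 4 * c ^+ 2 * (be + 2) * L * y.
Proof.
have [a_gt0 b_gt0 L_ge0 c_ge1] := And4 al0 be0 L0 c1.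
move=> y0 y2; have [sy1 sy2] := le_near1 y0 y2.
have sy : 0 < 1 + s * y by lra.
set p := 1 + s * y in sy1 sy2 sy *.
have W0 : 0 < y `^ al * p `^ be by rewrite mulr_gt0 ?powR_gt0.
pose psi' t := p `^ be * H y - psi t.
have mpsi' : measurable_fun [set: R] psi' by exact: measurable_funB.
have [C psiC] := psi_bounded y0 sy.
have intpsi := integrable_powRM al0 y0 mpsi psiC.
have intcst := integrable_powR al0 y0.
have DE : H y - al * core_sol y = al * (y `^ al * p `^ be)^-1 *
    \int[mu]_(t in `]0, y[) (t `^ (al - 1) * psi' t).
  have -> : \int[mu]_(t in `]0, y[) (t `^ (al - 1) * psi' t) =
      p `^ be * H y * (y `^ al / al) -
      \int[mu]_(t in `]0, y[) (t `^ (al - 1) * psi t).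
    transitivity (\int[mu]_(t in `]0, y[)
        (p `^ be * H y * t `^ (al - 1) - t `^ (al - 1) * psi t)).
      by apply: eq_Rintegral => t _; rewrite /psi' mulrBr mulrC.
    rewrite RintegralB//.
    - rewrite RintegralZl//; congr (_ * _ - _).
      by rewrite /Rintegral integral_powR.
    - rewrite /comp; under [X in integrable _ _ X]eq_fun do rewrite EFinM.
      by apply: integrableZl; [exact: measurable_itv|].
  rewrite /core_sol -/p -/psi; field.
  by rewrite !gt_eqF ?powR_gt0.
have psi'_le t : 0 < t -> t < y -> `|psi' t| <= 4 * c * (be + 2) * L * y.
  move=> t0 ty.
  have [st1 st2] := le_near1 t0 (le_trans (ltW ty) y2).
  rewrite /psi' /psi; set q := 1 + s * t in st1 st2 *.
  have pc : p `^ be <= c.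
    by apply: le_trans (powR_near1 be sy1 sy2) _; rewrite ger0_norm// ltW.
  have c2E : 2 `^ (be + 1) = 2 * c.
    rewrite /c mulrC powRD; last by rewrite pnatr_eq0 implybT.
    by rewrite powRr1.
  have qc : q `^ (be - 1) <= 2 * c.
    apply: le_trans (powR_near1 _ st1 st2) _; rewrite -c2E.
    apply: ler_powR; first lra.
    by rewrite ler_norml; apply/andP; split; lra.
  have Hyt : `|H y - H t| <= L * y.
    apply: le_trans ((klipschitzP _ _).1 HL y t) _.
    by rewrite ler_wpM2l// ger0_norm; lra.
  have Ht : `|H t| <= 2 * L.
    by apply: le_trans (H_le (ltW t0)) _; rewrite mulrC ler_wpM2r//; lra.
  have pq : `|p `^ be - q `^ be| <= be * (2 * c) * y.
    apply: le_trans (powR_dist be0 sy1 sy2 st1 st2) _; rewrite c2E.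
    rewrite ler_wpM2l ?mulr_ge0//; [lra..|].
    rewrite /p /q (_ : 1 + s * y - (1 + s * t) = s * (y - t)); last by ring.
    by rewrite normrM s_norm mul1r ger0_norm; lra.
  have q1 : `|q `^ be - q `^ (be - 1)| <= 2 * c * y.
    have -> : q `^ be - q `^ (be - 1) = q `^ (be - 1) * (s * t).
      rewrite (_ : q `^ be = q `^ (be - 1) * q); first by rewrite /q; ring.
      by rewrite mulrC mulr_powRB1//; lra.
    rewrite normrM (ger0_norm (powR_ge0 _ _)) ler_pM ?powR_ge0//.
    by rewrite normrM s_norm mul1r ger0_norm; lra.
  rewrite (_ : p `^ be * H y - H t * q `^ (be - 1) =
    p `^ be * (H y - H t) + H t * (p `^ be - q `^ be) + H t * (q `^ be - q `^ (be - 1)));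
    last by ring.
  apply: le_trans (ler_normD _ _) _.
  apply: (@le_trans _ _ (c * (L * y) + 2 * L * (be * (2 * c) * y) + 2 * L * (2 * c * y))).
    apply: lerD.
      apply: le_trans (ler_normD _ _) _; apply: lerD; rewrite normrM ler_pM//.
      by rewrite ger0_norm ?powR_ge0.
    by rewrite normrM ler_pM.
  rewrite -subr_ge0 (_ : _ - _ = 3 * c * L * y); last by ring.
  by rewrite !mulr_ge0//; lra.
rewrite DE normrM (gtr0_norm (_ : 0 < al * _)); last by rewrite mulr_gt0// invr_gt0.
apply: (@le_trans _ _ (al * (y `^ al * p `^ be)^-1 *
   (4 * c * (be + 2) * L * y * (y `^ al / al)))).
  rewrite ler_wpM2l//; first by rewrite mulr_ge0 ?invr_ge0// ltW.
  exact: Rintegral_powRM_le.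
rewrite (_ : al * _ * _ = 4 * c * (be + 2) * L * y * (p `^ be)^-1); last first.
  by field; rewrite !gt_eqF ?powR_gt0.
rewrite (_ : 4 * c ^+ 2 * _ * _ * _ = 4 * c * (be + 2) * L * y * c); last by ring.
rewrite ler_wpM2l//; first by rewrite !mulr_ge0//; lra.
rewrite -[leRHS]invrK lef_pV2 ?posrE ?powR_gt0 ?invr_gt0//; last lra.
exact: c_le.
Qed.

(** The multiple of 2 is the bound for [y <= 1/2], where [1 + s y >= 1/2]; the
    summand [2 + 8 * c] is added to cover [y > 1/2], where [s = 1]. *)
Definition core_const : R :=
  2 * (4 * c ^+ 2 * (be + 2) + (al + be) * (4 * c / al)) + 2 + 8 * c.

(** The singularity [1 / y] only concerns [H y - al * core_sol y], which is
    controlled by [core_sol_defect] near 0 and by [core_sol_le] far from it. *)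
Lemma core_sol_derive_le y : 0 < y -> y <= 2^-1 \/ s = 1 ->
  `|(H y - (al + s * (al + be) * y) * core_sol y) / (y * (1 + s * y))|
    <= core_const * L.
Proof.
have [a_gt0 b_gt0 L_ge0 c_ge1] := And4 al0 be0 L0 c1.
move=> y0 ys; have F_le := core_sol_le y0 ys.
have sy : 0 < 1 + s * y.
  by case: ys sE => [y2 [->|->]|-> _]; lra.
have cL : 0 <= c * L by rewrite mulr_ge0//; lra.
have cLa : 0 <= c * L / al by rewrite divr_ge0//; lra.
have ca : 0 <= c / al by rewrite divr_ge0//; lra.
have -> : (H y - (al + s * (al + be) * y) * core_sol y) / (y * (1 + s * y)) =
    ((H y - al * core_sol y) / y - s * (al + be) * core_sol y) / (1 + s * y).
  by field; rewrite !gt_eqF.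
have ab : 0 < al + be by rewrite addr_gt0.
have bF : `|s * (al + be) * core_sol y| <= (al + be) * (4 * c * L / al).
  rewrite normrM (normrM s) s_norm mul1r (gtr0_norm ab).
  exact: ler_wpM2l (ltW ab) _ _ F_le.
rewrite normrM normfV (gtr0_norm sy) ler_pdivrMr//.
apply: le_trans (ler_normB _ _) _.
rewrite normrM normfV (gtr0_norm y0).
have [y2|y2] := leP y 2^-1.
  have D := core_sol_defect y0 y2.
  have [sy1 _] := le_near1 y0 y2.
  have Dy : `|H y - al * core_sol y| / y <= 4 * c ^+ 2 * (be + 2) * L.
    by rewrite ler_pdivrMr.
  apply: le_trans (lerD Dy bF) _.
  apply: (@le_trans _ _ (core_const * L * 2^-1)).
    rewrite /core_const -subr_ge0.
    rewrite (_ : _ - _ = L + 4 * (c * L)); last by field; lra.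
    lra.
  rewrite ler_wpM2l// mulr_ge0// /core_const.
  have : 0 <= c ^+ 2 * (be + 2) by rewrite mulr_ge0 ?sqr_ge0//; lra.
  have : 0 <= (al + be) * (4 * c / al) by rewrite mulr_ge0 ?(ltW ab)//; lra.
  lra.
case: ys => [|s1']; first lra.
rewrite (_ : 1 + s * y = 1 + y); last by rewrite s1' mul1r.
have Hy := H_le (ltW y0).
have D : `|H y - al * core_sol y| / y <= 2 * L * (1 + y) + 8 * c * L.
  rewrite ler_pdivrMr//; apply: le_trans (ler_normB _ _) _.
  rewrite normrM (gtr0_norm al0).
  have aF : al * `|core_sol y| <= 4 * c * L.
    by rewrite -ler_pdivlMl// mulrC.
  apply: le_trans (lerD Hy aF) _; rewrite [leRHS]mulrDl; apply: lerD.
    by rewrite -subr_ge0 (_ : _ - _ = 2 * (L * (1 + y)) * (y - 2^-1)) ?mulr_ge0//; [lra..|field].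
  by rewrite -subr_ge0 (_ : _ - _ = 8 * (c * L) * (y - 2^-1)) ?mulr_ge0//; [lra..|field].
apply: le_trans (lerD D bF) _.
rewrite /core_const -subr_ge0.
rewrite (_ : _ - _ = 8 * (c ^+ 2 * (be + 2)) * L * (1 + y) + 8 * (c * L) * y
   + (al + be) * (4 * (c * L / al)) * (1 + 2 * y)); last by field; lra.
have c2 : 0 <= c ^+ 2 * (be + 2) by rewrite mulr_ge0 ?sqr_ge0//; lra.
move: (c ^+ 2 * (be + 2)) (c * L) c2 cL cLa => u w u0 w0 v0.
have t1 : 0 <= u * L * (1 + y) by rewrite !mulr_ge0//; lra.
have t2 : 0 <= w * y by rewrite mulr_ge0//; lra.
have t3 : 0 <= (al + be) * (w / al) * (1 + 2 * y).
  by apply: mulr_ge0; [apply: mulr_ge0|]; [exact: ltW|exact: v0|lra].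
lra.
Qed.

Lemma core_sol_cvg0 y : 0 < y -> y <= 2^-1 ->
  `|core_sol y - H 0 / al| <= (1 + 4 * c ^+ 2 * (be + 2)) * L / al * y.
Proof.
have [a_gt0 b_gt0 L_ge0 c_ge1] := And4 al0 be0 L0 c1.
move=> y0 y2; have D := core_sol_defect y0 y2.
rewrite -(ler_pM2l al0) -{1}(gtr0_norm al0) -normrM.
rewrite (_ : al * _ = (H y - H 0) - (H y - al * core_sol y)); last by field; lra.
apply: le_trans (ler_normB _ _) _.
have := (klipschitzP _ _).1 HL y 0; rewrite subr0 (gtr0_norm y0) => Hy.
apply: le_trans (lerD Hy D) _.
by rewrite -subr_ge0 (_ : _ - _ = 0)//; field; lra.
Qed.

End core.

(** * Integration against a density *)

Section integral_density.
Context d (T : measurableType d) (R : realType).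
Variables (nu mu : {measure set T -> \bar R}) (q : T -> R).
Hypotheses (mq : measurable_fun [set: T] q) (q0 : forall x, 0 <= q x).
Hypothesis nuE : forall A, measurable A -> nu A = (\int[mu]_(x in A) (q x)%:E)%E.
Local Open Scope ereal_scope.

Import HBNNSimple.

Let integral_density_nnsfun (g : {nnsfun T >-> R}) :
  \int[nu]_x (g x)%:E = \int[mu]_x ((g x)%:E * (q x)%:E).
Proof.
under [LHS]eq_integral do rewrite fimfunE -fsumEFin//.
rewrite ge0_integral_fsum//; last 2 first.
  - by move=> r; exact/measurable_EFinP/measurableT_comp.
  - by move=> r x _; rewrite EFinM nnfun_muleindic_ge0.
under [RHS]eq_integral => x _.
  rewrite fimfunE -fsumEFin// ge0_mule_fsuml; last first.
    by move=> r; rewrite EFinM nnfun_muleindic_ge0.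
  over.
rewrite [RHS]ge0_integral_fsum//; last 2 first.
  - move=> r; apply: emeasurable_funM; last exact/measurable_EFinP.
    by apply/measurable_EFinP; exact: measurable_funM.
  - move=> r x _; apply: mule_ge0; last by rewrite lee_fin.
    by rewrite EFinM nnfun_muleindic_ge0.
apply: eq_fsbigr => r /[!inE] -[t _ <-].
under eq_integral do rewrite EFinM.
under [RHS]eq_integral do rewrite EFinM -muleA.
rewrite integralZl_indic_nnsfun// integral_indic// setIT.
rewrite ge0_integralZl//; last 3 first.
  - apply: emeasurable_funM; apply/measurable_EFinP => //.
  - by move=> x _; rewrite mule_ge0 ?lee_fin.
  - by rewrite lee_fin.
congr (_ * _); rewrite nuE// [LHS]integral_mkcond/=.
apply: eq_integral => x _; rewrite patchE indicE.
by case: ifPn => _; rewrite ?mul1e ?mul0e.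
Qed.

Lemma ge0_integral_density (f : T -> \bar R) :
  measurable_fun [set: T] f -> (forall x, 0 <= f x) ->
  \int[nu]_x f x = \int[mu]_x (f x * (q x)%:E).
Proof.
move=> mf f0; pose g := nnsfun_approx measurableT mf.
have g_cvg x : (g n x)%:E @[n --> \oo] --> f x by exact: cvg_nnsfun_approx.
transitivity (lim (\int[nu]_x (g n x)%:E @[n --> \oo])).
  rewrite -monotone_convergence//=.
  - by apply: eq_integral => x _; exact/esym/cvg_lim.
  - by move=> n; exact/measurable_EFinP/measurable_funTS.
  - by move=> n x _; rewrite lee_fin.
  - by move=> x _ m n mn; rewrite lee_fin; exact/lefP/nd_nnsfun_approx.
under eq_fun do rewrite integral_density_nnsfun.
rewrite -monotone_convergence//=.
- apply: eq_integral => x _; apply/cvg_lim => //.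
  by apply: cvgeZr.
- move=> n; apply: emeasurable_funM; apply/measurable_EFinP => //.
- by move=> n x _; rewrite mule_ge0 ?lee_fin.
- move=> x _ m n mn; rewrite lee_wpmul2r ?lee_fin//.
  exact/lefP/nd_nnsfun_approx.
Qed.

Lemma Rintegral_density (h : T -> R) : measurable_fun [set: T] h ->
  (\int[nu]_x h x = \int[mu]_x (h x * q x))%R.
Proof.
move=> mh; rewrite /Rintegral integralE [in RHS]integralE.
have mEh : measurable_fun [set: T] (EFin \o h) by exact/measurable_EFinP.
have hp : (EFin \o (fun x => (h x * q x)%R))^\+ = (fun x => (EFin \o h)^\+ x * (q x)%:E).
  apply/funext => x; rewrite !funeposE /= [RHS]muleC.
  by rewrite maxe_pMr ?lee_fin// mule0 -EFinM mulrC.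
have hn : (EFin \o (fun x => (h x * q x)%R))^\- = (fun x => (EFin \o h)^\- x * (q x)%:E).
  apply/funext => x; rewrite !funenegE /= [RHS]muleC.
  by rewrite maxe_pMr ?lee_fin// mule0 -EFinM mulrN mulrC.
congr (fine (_ - _)).
- rewrite ge0_integral_density//; last exact: measurable_funepos.
  by apply: eq_integral => x _; rewrite -[RHS]/((EFin \o (fun x => (h x * q x)%R))^\+ x) hp.
- rewrite ge0_integral_density//; last exact: measurable_funeneg.
  by apply: eq_integral => x _; rewrite -[RHS]/((EFin \o (fun x => (h x * q x)%R))^\- x) hn.
Qed.

End integral_density.

(** * Reflections and translations of the line *)

Section affine_substitution.
Context {R : realType}.
Notation mu := (@lebesgue_measure R).

Definition affine (k s : R) (t : R) : R := k + s * t.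

Lemma measurable_affine k s :
  measurable_fun [set: measurableTypeR R] (affine k s : _ -> measurableTypeR R).
Proof. by apply: measurable_funD => //; exact: measurable_funM. Qed.

Variables (k s : R).
Hypothesis sE : s = 1 \/ s = -1.

Lemma lebesgue_measure_affine (A : set R) : measurable A ->
  pushforward mu (affine k s : _ -> measurableTypeR R) A = mu A.
Proof.
move=> mA; apply/esym; apply: lebesgue_measure_unique => //=.
  exact: measurable_affine.
move=> ? _ [[a b]] _ <-.
rewrite /pushforward/=.
case: sE => ->.
  rewrite (_ : _ @^-1` _ = `]a - k, b - k]%classic); last first.
    by apply/seteqP; split => t /=; rewrite !in_itv/= /affine mul1r =>
      /andP[? ?]; apply/andP; split; lra.
  rewrite !lebesgue_measure_itv/= !lte_fin ltrD2r -!EFinB.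
  by case: ifP => // _; congr EFin; ring.
rewrite (_ : _ @^-1` _ = `[k - b, k - a[%classic); last first.
  by apply/seteqP; split => t /=; rewrite !in_itv/= /affine mulN1r =>
    /andP[? ?]; apply/andP; split; lra.
rewrite !lebesgue_measure_itv/= !lte_fin ltrD2l ltrN2 -!EFinB.
by case: ifP => // _; congr EFin; ring.
Qed.

Lemma ge0_integral_affine (f : R -> \bar R) (D : set R) : measurable D ->
  measurable_fun D f -> (forall x, D x -> (0 <= f x)%E) ->
  (\int[mu]_(t in D) f t = \int[mu]_(t in affine k s @^-1` D) f (affine k s t))%E.
Proof.
move=> mD mf f0.
rewrite -(@ge0_integral_pushforward _ _ (measurableTypeR R) (measurableTypeR R) R
  (affine k s) (measurable_affine k s) lebesgue_measure D f)//.
  apply: eq_measure_integral => [|? A mA _]; first exact: measurable_affine.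
  exact/esym/lebesgue_measure_affine.
by move=> x /set_mem; exact: f0.
Qed.

Lemma Rintegral_affine (f : R -> R) (D : set R) : measurable D ->
  measurable_fun D f ->
  \int[mu]_(t in D) f t = \int[mu]_(t in affine k s @^-1` D) f (affine k s t).
Proof.
move=> mD mf; rewrite /Rintegral integralE [in RHS]integralE.
have mEf : measurable_fun D (EFin \o f) by exact/measurable_EFinP.
congr (fine (_ - _)).
- rewrite ge0_integral_affine//; last exact: measurable_funepos.
  by apply: eq_integral => t _; rewrite !funeposE.
- rewrite ge0_integral_affine//; last exact: measurable_funeneg.
  by apply: eq_integral => t _; rewrite !funenegE.
Qed.

End affine_substitution.

(** * The Beta distribution *)

Section beta_weight.
Context {R : realType}.
Notation mu := (@lebesgue_measure R).
Implicit Types a b : R.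

Definition beta_weight a b (t : R) : R := t `^ (a - 1) * (1 - t) `^ (b - 1).

Lemma measurable_beta_weight a b : measurable_fun [set: R] (beta_weight a b).
Proof.
apply: measurable_funM; first exact: measurable_powR.
apply: (@measurableT_comp _ _ _ _ _ _ (fun v : R => v `^ (b - 1))).
  exact: measurable_powR.
exact: measurable_funB.
Qed.

Lemma beta_weight_ge0 a b t : 0 <= beta_weight a b t.
Proof. by rewrite mulr_ge0 ?powR_ge0. Qed.

Lemma integrable_powR_onem b : 0 < b ->
  mu.-integrable `]0, 1[ (fun t : R => ((1 - t) `^ (b - 1))%:E).
Proof.
move=> b0; apply/integrableP; split.
  apply/measurable_EFinP; apply: measurable_funTS.
  apply: (@measurableT_comp _ _ _ _ _ _ (fun v : R => v `^ (b - 1))).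
    exact: measurable_powR.
  exact: measurable_funB.
under eq_integral do rewrite gee0_abs ?lee_fin ?powR_ge0//.
have -> : (\int[mu]_(t in `]0%R, 1%R[) ((1 - t) `^ (b - 1))%:E =
    \int[mu]_(t in `]0%R, 1%R[) (t `^ (b - 1))%:E)%E.
  have E01 : affine 1 (-1) @^-1` `]0, 1[%classic = `]0, 1[%classic :> set R.
    by apply/seteqP; split => t /=; rewrite !in_itv/= /affine mulN1r =>
      /andP[? ?]; apply/andP; split; lra.
  have w0 (t : R) : `]0, 1[%classic t -> (0 <= (t `^ (b - 1))%:E)%E.
    by move=> _; rewrite lee_fin powR_ge0.
  have := ge0_integral_affine 1 (or_intror erefl) (measurable_itv _)
    (@measurable_powR_EFin R (b - 1) _) w0.
  rewrite E01 => ->; apply: eq_integral => t _.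
  by rewrite /affine mulN1r.
by rewrite integral_powR// ltry.
Qed.

Lemma powR_half_le (v s : R) : 2^-1 <= v -> v <= 1 -> v `^ s <= 2 `^ `|s|.
Proof. by move=> v1 v2; apply: powR_near1 => //; lra. Qed.

Lemma powR_half_ge (v s : R) : 2^-1 <= v -> v <= 1 -> (2 `^ `|s|)^-1 <= v `^ s.
Proof.
move=> v1 v2; have v0 : 0 < v by lra.
rewrite -[leRHS]invrK lef_pV2 ?posrE ?invr_gt0 ?powR_gt0//.
by rewrite -powRN -(normrN s); exact: powR_half_le.
Qed.

(** On each half of the interval, one of the two factors is bounded. *)
Lemma beta_weight_le a b t : 0 < t -> t < 1 ->
  beta_weight a b t <= 2 `^ `|b - 1| * t `^ (a - 1) + 2 `^ `|a - 1| * (1 - t) `^ (b - 1).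
Proof.
move=> t0 t1; rewrite /beta_weight; have [t2|/ltW t2] := leP t 2^-1.
  rewrite mulrC (@le_trans _ _ (2 `^ `|b - 1| * t `^ (a - 1)))//.
    by rewrite ler_wpM2r ?powR_ge0//; apply: powR_half_le; lra.
  by rewrite lerDl mulr_ge0 ?powR_ge0.
rewrite (@le_trans _ _ (2 `^ `|a - 1| * (1 - t) `^ (b - 1)))//.
  by rewrite ler_wpM2r ?powR_ge0//; apply: powR_half_le; lra.
by rewrite lerDr mulr_ge0 ?powR_ge0.
Qed.

Lemma integrable_beta_weight a b : 0 < a -> 0 < b ->
  mu.-integrable `]0, 1[ (EFin \o beta_weight a b).
Proof.
move=> a0 b0.
apply: (@le_integrable _ _ _ mu _ (measurable_itv _) _ (fun t : R =>
   ((2 `^ `|b - 1|)%:E * (t `^ (a - 1))%:E + (2 `^ `|a - 1|)%:E * ((1 - t) `^ (b - 1))%:E)%E)).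
- by apply/measurable_EFinP; apply: measurable_funTS; exact: measurable_beta_weight.
- move=> t /=; rewrite in_itv/= => /andP[t0 t1].
  rewrite lee_fin ger0_norm ?beta_weight_ge0//.
  exact: le_trans (beta_weight_le _ _ t0 t1) (ler_norm _).
- apply: integrableD; first exact: measurable_itv.
    by apply: integrableZl; [exact: measurable_itv|exact: integrable_powR].
  by apply: integrableZl; [exact: measurable_itv|exact: integrable_powR_onem].
Qed.

Lemma euler_betaE a b : euler_beta a b = \int[mu]_(t in `]0, 1[) beta_weight a b t.
Proof. by []. Qed.

(** On the left half of the interval the weight dominates a multiple of
    [t ^ (a - 1)], whose integral is explicit. *)
Lemma euler_beta_gt0 a b : 0 < a -> 0 < b -> 0 < euler_beta a b.
Proof.
move=> a0 b0; rewrite euler_betaE.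
pose m : R := (2 `^ `|b - 1|)^-1.
have m0 : 0 < m by rewrite invr_gt0 powR_gt0.
have h0 : 0 < 2^-1 :> R by [].
apply: (@lt_le_trans _ _ (m * ((2^-1) `^ a / a))).
  by rewrite !mulr_gt0 ?invr_gt0 ?powR_gt0.
apply: (@le_trans _ _ (\int[mu]_(t in `]0, 2^-1[) beta_weight a b t)).
  rewrite (_ : _ / a = \int[mu]_(t in `]0, 2^-1[) (t `^ (a - 1))); last first.
    by rewrite /Rintegral integral_powR.
  have int1 := integrable_powR a0 h0.
  rewrite -RintegralZl//; apply: le_Rintegral => //.
  - rewrite /comp; under [X in integrable _ _ X]eq_fun do rewrite EFinM.
    by apply: integrableZl; [exact: measurable_itv|].
  - apply: integrableS (integrable_beta_weight a0 b0) => //.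
    by apply: subset_itvl; rewrite bnd_simp; lra.
  - move=> t; rewrite /= in_itv/= => /andP[t0 t2].
    rewrite /beta_weight mulrC ler_wpM2l ?powR_ge0//.
    by apply: powR_half_ge; lra.
rewrite /Rintegral fine_le//.
- apply: integrable_fin_num => //.
  apply: integrableS (integrable_beta_weight a0 b0) => //.
  by apply: subset_itvl; rewrite bnd_simp; lra.
- by apply: integrable_fin_num => //; exact: integrable_beta_weight.
- apply: ge0_subset_integral => //.
  + by apply: measurable_int; exact: integrable_beta_weight.
  + by move=> t _; rewrite lee_fin beta_weight_ge0.
  + by apply: subset_itvl; rewrite bnd_simp; lra.
Qed.

End beta_weight.

Section beta_mean.
Context {R : realType}.
Notation mu := (@lebesgue_measure R).
Variables (a b : R).
Hypotheses (a0 : 0 < a) (b0 : 0 < b).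
Implicit Types (h : R -> R) (L : R).

Lemma beta_mean_density h : measurable_fun [set: R] h ->
  beta_mean a b h = \int[mu]_(t in `]0, 1[) ((euler_beta a b)^-1 * (h t * beta_weight a b t)).
Proof.
move=> mh; rewrite /beta_mean.
rewrite (@Rintegral_density _ (measurableTypeR R) R
  (beta_distr a b) lebesgue_measure (beta_density a b))//.
- rewrite [RHS]Rintegral_mkcond; apply: eq_Rintegral => t _.
  rewrite patchE /beta_density indicE; case: ifPn => _; last by rewrite !mulr0.
  by rewrite mulr1 mulrCA.
- exact: measurable_beta_density.
- exact: beta_density_ge0.
Qed.

Lemma klipschitz_measurable h L (D : set R) : L.-lipschitz h -> measurable_fun D h.
Proof.
move=> hL; apply: measurable_funTS; apply: continuous_measurable_fun.
exact: klipschitz_continuous hL.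
Qed.

Lemma integrable_klipschitz_weight h L : L.-lipschitz h ->
  mu.-integrable `]0, 1[ (fun t : R => (h t * beta_weight a b t)%:E).
Proof.
move=> hL; have L0 := klipschitz_ge0 hL.
apply: (@le_integrable _ _ _ mu _ (measurable_itv _) _
  (fun t : R => ((`|h 0| + L)%:E * (beta_weight a b t)%:E)%E)).
- apply/measurable_EFinP; apply: measurable_funM; first exact: klipschitz_measurable hL.
  by apply: measurable_funTS; exact: measurable_beta_weight.
- move=> t /=; rewrite in_itv/= => /andP[t0 t1].
  rewrite lee_fin !normrM ler_wpM2r//.
  rewrite (_ : h t = h 0 + (h t - h 0)); last by ring.
  apply: le_trans (ler_normD _ _) _.
  rewrite (@ger0_norm _ (`|h 0| + L)) ?addr_ge0// lerD2l.
  apply: le_trans ((klipschitzP _ _).1 hL t 0) _.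
  by rewrite subr0 (gtr0_norm t0) ler_piMr// ltW.
- apply: integrableZl; [exact: measurable_itv|exact: integrable_beta_weight].
Qed.

Lemma beta_mean_weight h L : L.-lipschitz h ->
  \int[mu]_(t in `]0, 1[) (h t * beta_weight a b t) = euler_beta a b * beta_mean a b h.
Proof.
move=> hL; have B0 := euler_beta_gt0 a0 b0.
rewrite beta_mean_density; last exact: klipschitz_measurable hL.
rewrite RintegralZl//; last exact: integrable_klipschitz_weight hL.
by rewrite mulrA mulfV ?mul1r// gt_eqF.
Qed.

Lemma klipschitzB_cst h L k : L.-lipschitz h -> L.-lipschitz (fun t => h t - k).
Proof.
move=> hL; apply/klipschitzP => x y.
by rewrite opprB addrA subrK; exact: (klipschitzP _ _).1 hL x y.
Qed.

Lemma integral_centered_weight h L : L.-lipschitz h ->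
  \int[mu]_(t in `]0, 1[) ((h t - beta_mean a b h) * beta_weight a b t) = 0.
Proof.
move=> hL.
have intw := integrable_beta_weight a0 b0.
transitivity (\int[mu]_(t in `]0, 1[)
    (h t * beta_weight a b t - beta_mean a b h * beta_weight a b t)).
  by apply: eq_Rintegral => t _; rewrite mulrBl.
rewrite RintegralB//.
- rewrite (beta_mean_weight hL) RintegralZl// -euler_betaE.
  by rewrite mulrC subrr.
- exact: integrable_klipschitz_weight hL.
- rewrite /comp; under [X in integrable _ _ X]eq_fun do rewrite EFinM.
  by apply: integrableZl; [exact: measurable_itv|].
Qed.

(** The mean is an average of [h] over [0, 1], an interval of length 1. *)
Lemma centered_le h L x : L.-lipschitz h -> 0 <= x -> x <= 1 ->
  `|h x - beta_mean a b h| <= L.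
Proof.
move=> hL x0 x1; have L0 := klipschitz_ge0 hL.
have B0 := euler_beta_gt0 a0 b0.
have intw := integrable_beta_weight a0 b0.
have hxL : L.-lipschitz (fun t => h t - h x) by exact: klipschitzB_cst.
have inthx := integrable_klipschitz_weight hxL.
have E : euler_beta a b * (beta_mean a b h - h x) =
    \int[mu]_(t in `]0, 1[) ((h t - h x) * beta_weight a b t).
  transitivity (\int[mu]_(t in `]0, 1[)
      (h t * beta_weight a b t - h x * beta_weight a b t)); last first.
    by apply: eq_Rintegral => t _; rewrite mulrBl.
  rewrite RintegralB//.
  - rewrite (beta_mean_weight hL) RintegralZl// -euler_betaE.
    by rewrite mulrBr (mulrC (h x)).
  - exact: integrable_klipschitz_weight hL.
  - rewrite /comp; under [X in integrable _ _ X]eq_fun do rewrite EFinM.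
    by apply: integrableZl; [exact: measurable_itv|].
rewrite distrC -(ler_pM2l B0) -{1}(gtr0_norm B0) -normrM E.
apply: le_trans; first by apply: le_normr_Rintegral.
rewrite (_ : _ * L = \int[mu]_(t in `]0, 1[) (L * beta_weight a b t)); last first.
  by rewrite RintegralZl// -euler_betaE mulrC.
apply: le_Rintegral => //.
- by have := integrable_norm inthx.
- rewrite /comp; under [X in integrable _ _ X]eq_fun do rewrite EFinM.
  by apply: integrableZl; [exact: measurable_itv|].
- move=> t; rewrite /= in_itv/= => /andP[t0 t1].
  rewrite normrM (ger0_norm (beta_weight_ge0 _ _ _)) ler_wpM2r ?beta_weight_ge0//.
  apply: le_trans ((klipschitzP _ _).1 hL t x) _.
  by rewrite ler_piMr// ler_norml; apply/andP; split; lra.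
Qed.

End beta_mean.

(** * The Stein solution on the two sides of 0 and 1 *)

Section stein_sol_sides.
Context {R : realType}.
Notation mu := (@lebesgue_measure R).
Variables (a b L : R) (h : R -> R).
Hypotheses (a0 : 0 < a) (b0 : 0 < b) (hL : L.-lipschitz h).

Let hh t := h t - beta_mean a b h.

Let mhh (D : set R) : measurable_fun D hh.
Proof. exact: klipschitz_measurable (klipschitzB_cst _ hL). Qed.

Let mpow (k s c : R) (D : set R) : measurable_fun D (fun t => (k + s * t) `^ c).
Proof.
apply: measurable_funTS.
apply: (@measurableT_comp _ _ _ _ _ _ (fun v : R => v `^ c)).
  exact: measurable_powR.
by apply: measurable_funD => //; exact: measurable_funM.
Qed.

Lemma stein_sol_lt0 x : x < 0 ->
  stein_sol a b h x = core_sol a b 1 (hh \o affine 0 (-1)) (- x).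
Proof.
move=> x0; rewrite /stein_sol x0 /core_sol mul1r ltr0_norm//; congr (_ * _).
rewrite [LHS](@Rintegral_affine R 0 (-1) (or_intror erefl))//; last first.
  apply: measurable_funM; first apply: measurable_funM => //.
  - apply: measurable_funTS; apply: (@measurableT_comp _ _ _ _ _ _ (fun v : R => v `^ (a - 1))) => //.
  - rewrite (_ : (fun t => _) = (fun t => (1 + -1 * t) `^ (b - 1))); first exact: mpow.
    by apply/funext => t; rewrite mulN1r.
rewrite (_ : _ @^-1` _ = `]0, - x[%classic); last first.
  by apply/seteqP; split => t /=; rewrite !in_itv/= /affine =>
    /andP[? ?]; apply/andP; split; lra.
apply: eq_Rintegral => t; rewrite inE/= in_itv/= => /andP[t0 _].
rewrite {2 3}/affine add0r mulN1r normrN (gtr0_norm t0) opprK mul1r.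
by rewrite -mulrA mulrCA.
Qed.

Lemma stein_sol_left x : 0 < x -> x < 1 ->
  stein_sol a b h x = core_sol a b (-1) (hh \o affine 0 1) x.
Proof.
move=> x0 x1; have B0 := euler_beta_gt0 a0 b0.
rewrite /stein_sol ltNge (ltW x0)/= gt_eqF// x1.
have xin : x \in `]0, 1[%classic by rewrite inE/= in_itv/= x0.
pose I := \int[mu]_(t in `]0, x[) (hh t * beta_weight a b t).
have -> : \int[mu]_(t in `]0, x[) (hh t * beta_density a b t) = (euler_beta a b)^-1 * I.
  rewrite -RintegralZl//.
  - apply: eq_Rintegral => t; rewrite inE/= in_itv/= => /andP[t0 tx].
    rewrite /beta_density indicE mem_set ?mulr1; first by rewrite mulrCA.
    by rewrite /= in_itv/= t0 (lt_trans tx).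
  - apply: integrableS (integrable_klipschitz_weight a0 b0 (klipschitzB_cst _ hL)) => //.
    by apply: subset_itvl; rewrite bnd_simp ltW.
have -> : core_sol a b (-1) (hh \o affine 0 1) x = (x `^ a * (1 - x) `^ b)^-1 * I.
  rewrite /core_sol (mulN1r x); apply: (congr1 (fun u => _ * u)).
  apply: eq_Rintegral => t _.
  by rewrite /= /affine add0r mul1r (mulN1r t) /beta_weight mulrCA.
rewrite /beta_density indicE xin mulr1.
have [x00 x10] : x != 0 /\ 1 - x != 0 by split; apply: lt0r_neq0; lra.
rewrite -(mulr_powRB1 (ltW x0) a0) -(mulr_powRB1 _ b0) ?subr_ge0 ?(ltW x1)//.
have pa : x `^ (a - 1) != 0 by rewrite gt_eqF ?powR_gt0.
have pb : (1 - x) `^ (b - 1) != 0 by rewrite gt_eqF ?powR_gt0 ?subr_gt0.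
move: (x `^ (a - 1)) ((1 - x) `^ (b - 1)) pa pb => A B A0 B1.
by field; rewrite A0 B1 x00 x10 gt_eqF.
Qed.

(** The integral of the centred test function against the Beta weight vanishes, so
    on [0, 1] the solution may also be computed from the right end. This gives the
    estimates near 1, where the expression of [stein_sol_left] degenerates. *)
Lemma stein_sol_right x : 0 < x -> x < 1 ->
  stein_sol a b h x = - core_sol b a (-1) (hh \o affine 1 (-1)) (1 - x).
Proof.
move=> x0 x1; rewrite stein_sol_left// /core_sol (mulN1r x) (mulN1r (1 - x)).
have iw := integrable_klipschitz_weight a0 b0 (klipschitzB_cst (beta_mean a b h) hL).
pose I u := \int[mu]_(t in u) (hh t * beta_weight a b t).
have I0 : I `]0, x[ = - I `]x, 1[.
  have := @Rintegral_itvB R (fun t => hh t * beta_weight a b t) (BRight 0) (BLeft 1) x iw (ltW x0) x1.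
  rewrite (integral_centered_weight a0 b0 hL) sub0r => E.
  have J : I `]0, x[ = I `]0, x].
    apply: Rintegral_itv_bndo_bndc.
    by apply: integrableS iw => //; apply: subset_itvl; rewrite bnd_simp ltW.
  by rewrite J -[RHS]/(- \int[mu]_(t in [set` Interval (BRight x) (BLeft 1)]) (hh t * beta_weight a b t)) -E opprK.
have -> : \int[mu]_(t in `]0, x[) (t `^ (a - 1) *
    ((hh \o affine 0 1) t * (1 + -1 * t) `^ (b - 1))) = I `]0, x[.
  apply: eq_Rintegral => t _.
  by rewrite /= /affine add0r mul1r mulN1r /beta_weight mulrCA.
have I1 : I `]x, 1[ = \int[mu]_(t in `]0, 1 - x[) (t `^ (b - 1) *
    ((hh \o affine 1 (-1)) t * (1 + -1 * t) `^ (a - 1))).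
  have mf : measurable_fun `]x, 1[ (fun t => hh t * beta_weight a b t).
    by apply: measurable_funM => //; apply: measurable_funTS; exact: measurable_beta_weight.
  apply: (etrans (Rintegral_affine 1 (or_intror erefl) (measurable_itv _) mf)).
  rewrite (_ : _ @^-1` _ = `]0, 1 - x[%classic); last first.
    by apply/seteqP; split => t /=; rewrite !in_itv/= /affine =>
    /andP[? ?]; apply/andP; split; lra.
  apply: eq_Rintegral => t _; rewrite /= /beta_weight.
  by rewrite {2 3}/affine !mulN1r subKr mulrA mulrC.
by rewrite I0 mulrN I1 subKr (mulrC (x `^ a)).
Qed.

Lemma stein_sol_gt1 x : 1 < x ->
  stein_sol a b h x = - core_sol b a 1 (hh \o affine 1 1) (x - 1).
Proof.
move=> x1; have x0 : 0 < x by lra.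
rewrite /stein_sol ltNge (ltW x0)/= gt_eqF// ltNge (ltW x1)/= gt_eqF//.
rewrite /core_sol mul1r; congr (- (_ * _)).
  by rewrite (addrC 1) subrK mulrC.
rewrite [LHS](@Rintegral_affine R 1 1 (or_introl erefl))//; last first.
  apply: measurable_funM; first apply: measurable_funM => //.
  - by apply: measurable_funTS.
  - rewrite (_ : (fun t => _) = (fun t => (-1 + 1 * t) `^ (b - 1))); first exact: mpow.
    by apply/funext => t; rewrite mul1r addrC.
rewrite (_ : _ @^-1` _ = `]0, x - 1[%classic); last first.
  by apply/seteqP; split => t /=; rewrite !in_itv/= /affine =>
    /andP[? ?]; apply/andP; split; lra.
apply: eq_Rintegral => t _.
rewrite {2 3}/affine mul1r (addrC 1 t) addrK (addrC t).
by rewrite mulrC.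
Qed.

End stein_sol_sides.

(** * The first-order bound *)

Section stein_sol_regularity.
Context {R : realType}.
Implicit Types (a b L x : R) (h : R -> R).

Definition stein_const1 a b : R := core_const a b + core_const b a.

(** The derivative that the Stein equation prescribes outside 0 and 1. *)
Definition stein_slope a b h x : R :=
  (h x - beta_mean a b h - (a - (a + b) * x) * stein_sol a b h x) / (x * (1 - x)).

Variables (a b L : R) (h : R -> R).
Hypotheses (a0 : 0 < a) (b0 : 0 < b) (hL : L.-lipschitz h).
Let hh t := h t - beta_mean a b h.
Let f := stein_sol a b h.

Lemma core_const_ge0 (al be : R) : 0 < al -> 0 < be -> 0 <= core_const al be.
Proof.
move=> al0 be0; rewrite /core_const.
have c0 : 0 <= 2 `^ be :> R by exact: powR_ge0.
have ab : 0 <= al + be by rewrite addr_ge0 ?ltW.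
have t1 : 0 <= (2 `^ be) ^+ 2 * (be + 2) by rewrite mulr_ge0 ?sqr_ge0// addr_ge0 ?ltW.
have t2 : 0 <= (al + be) * (4 * 2 `^ be / al).
  by rewrite mulr_ge0// divr_ge0 ?mulr_ge0// ltW.
lra.
Qed.

Lemma klipschitz_affine k s : s = 1 \/ s = -1 -> L.-lipschitz (hh \o affine k s).
Proof.
move=> sE; apply/klipschitzP => x y; rewrite /= /hh opprB addrA subrK.
apply: le_trans ((klipschitzP _ _).1 hL _ _) _.
rewrite /affine (_ : k + s * x - _ = s * (x - y)); last by ring.
by rewrite normrM; case: sE => ->; rewrite ?normrN normr1 mul1r.
Qed.

Let h0L : `|(hh \o affine 0 1) 0| <= L.
Proof. by rewrite /= /affine mul1r addr0; exact: centered_le. Qed.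

Let h0L' : `|(hh \o affine 0 (-1)) 0| <= L.
Proof. by rewrite /= /affine mulr0 addr0; exact: centered_le. Qed.

Let h1L : `|(hh \o affine 1 1) 0| <= L.
Proof. by rewrite /= /affine mulr0 addr0; exact: centered_le. Qed.

Let h1L' : `|(hh \o affine 1 (-1)) 0| <= L.
Proof. by rewrite /= /affine mulr0 addr0; exact: centered_le. Qed.

Let L0 : 0 <= L. Proof. exact: klipschitz_ge0 hL. Qed.

Lemma is_derive1_stein_sol x : x != 0 -> x != 1 ->
  is_derive x 1 f (stein_slope a b h x).
Proof.
move=> x0 x1; have nx1 : 1 - x != 0 by rewrite subr_eq0 eq_sym.
have nx1' : x - 1 != 0 by rewrite subr_eq0.
have [xl|xg|xe] := ltgtP x 0; last by rewrite xe eqxx in x0.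
- have nx0 : 0 < - x by rewrite oppr_gt0.
  have sx : 0 < 1 + 1 * - x by lra.
  have := is_derive1_core_sol b a0 (or_introl erefl)
    (klipschitz_affine 0 (or_intror erefl)) h0L' nx0 sx.
  rewrite -[X in is_derive X](_ : 0 + -1 * x = - x); last by rewrite add0r mulN1r.
  move=> /is_derive1_affine_comp D.
  apply: (@is_derive1_near _ (fun t => core_sol a b 1 (hh \o affine 0 (-1)) (0 + -1 * t))).
    near=> t; rewrite add0r mulN1r -(stein_sol_lt0 a b hL)//.
    by near: t; exact: lt_nbhsl.
  apply: (is_derive1_eq D).
  rewrite -(stein_sol_lt0 a b hL xl) /stein_slope /= /affine -/(hh x).
  rewrite (_ : 0 + -1 * - x = x); last by ring.
  rewrite -/f; field.
  by rewrite ?mulN1r ?mul1r ?nx1 ?nx1' ?x0.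
- have [xl1|xg1|xe1] := ltgtP x 1; last by rewrite xe1 eqxx in x1.
    have sx : 0 < 1 + -1 * x by lra.
    have D := is_derive1_core_sol b a0 (or_intror erefl)
      (klipschitz_affine 0 (or_introl erefl)) h0L xg sx.
    apply: (@is_derive1_near _ (core_sol a b (-1) (hh \o affine 0 1))).
      near=> t; rewrite -(stein_sol_left a0 b0 hL)//.
        by near: t; exact: lt_nbhsr.
      by near: t; exact: lt_nbhsl.
    apply: (is_derive1_eq D).
    rewrite -(stein_sol_left a0 b0 hL xg xl1) /stein_slope /= /affine -/(hh x).
    rewrite (_ : 0 + 1 * x = x); last by ring.
    rewrite -/f; field.
    by rewrite ?mulN1r ?mul1r ?nx1 ?nx1' ?x0.
  have x10 : 0 < x - 1 by lra.
  have sx : 0 < 1 + 1 * (x - 1) by lra.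
  have := is_derive1_core_sol a b0 (or_introl erefl)
    (klipschitz_affine 1 (or_introl erefl)) h1L x10 sx.
  rewrite -[X in is_derive X](_ : -1 + 1 * x = x - 1); last by ring.
  move=> /is_derive1_affine_comp/(is_derive1Ml (-1)) D.
  apply: (@is_derive1_near _ (fun t => -1 * core_sol b a 1 (hh \o affine 1 1) (-1 + 1 * t))).
    near=> t; rewrite mulN1r mul1r (addrC (-1)) -(stein_sol_gt1 a b hL)//.
    by near: t; exact: lt_nbhsr.
  apply: (is_derive1_eq D).
  have -> : core_sol b a 1 (hh \o affine 1 1) (x - 1) = - f x.
    by rewrite /f (stein_sol_gt1 a b hL)// opprK.
  rewrite /stein_slope /= /affine -/(hh x).
  rewrite (_ : 1 + 1 * (x - 1) = x); last by ring.
  rewrite -/f; field.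
  by rewrite ?mulN1r ?mul1r ?nx1 ?nx1' ?x0.
Unshelve. all: by end_near. Qed.

Lemma stein_slope_le x : x != 0 -> x != 1 ->
  `|stein_slope a b h x| <= stein_const1 a b * L.
Proof.
move=> x0 x1; have nx1 : 1 - x != 0 by rewrite subr_eq0 eq_sym.
have nx1' : x - 1 != 0 by rewrite subr_eq0.
have Kab : core_const a b * L <= stein_const1 a b * L.
  by rewrite ler_wpM2r// lerDl core_const_ge0.
have Kba : core_const b a * L <= stein_const1 a b * L.
  by rewrite ler_wpM2r// lerDr core_const_ge0.
have [xl|xg|xe] := ltgtP x 0; last by rewrite xe eqxx in x0.
- have nx0 : 0 < - x by rewrite oppr_gt0.
  have := core_sol_derive_le a0 b0 (or_introl erefl)
    (klipschitz_affine 0 (or_intror erefl)) h0L' nx0 (or_intror erefl).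
  rewrite -(stein_sol_lt0 a b hL xl) /= /affine (_ : 0 + -1 * - x = x); last by ring.
  move=> D; apply: le_trans (le_trans D Kab); rewrite le_eqVlt; apply/orP; left; apply/eqP.
  rewrite /stein_slope -/(hh x) -/f -normrN; congr (`|_|).
  by field; rewrite ?mulN1r ?mul1r ?nx1 ?nx1' ?x0.
- have [xl1|xg1|xe1] := ltgtP x 1; last by rewrite xe1 eqxx in x1.
    have [x2|/ltW x2] := leP x 2^-1.
      have := core_sol_derive_le a0 b0 (or_intror erefl)
        (klipschitz_affine 0 (or_introl erefl)) h0L xg (or_introl x2).
      rewrite -(stein_sol_left a0 b0 hL xg xl1) /= /affine (_ : 0 + 1 * x = x); last by ring.
      move=> D; apply: le_trans (le_trans D Kab); rewrite le_eqVlt; apply/orP; left; apply/eqP.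
      rewrite /stein_slope -/(hh x) -/f; congr (`|_|).
      by field; rewrite ?mulN1r ?mul1r ?nx1 ?nx1' ?x0.
    have y0 : 0 < 1 - x by lra.
    have y2 : 1 - x <= 2^-1 by lra.
    have := core_sol_derive_le b0 a0 (or_intror erefl)
      (klipschitz_affine 1 (or_intror erefl)) h1L' y0 (or_introl y2).
    have -> : core_sol b a (-1) (hh \o affine 1 (-1)) (1 - x) = - f x.
      by rewrite /f (stein_sol_right a0 b0 hL)// opprK.
    rewrite /= /affine (_ : 1 + -1 * (1 - x) = x); last by ring.
    move=> D; apply: le_trans (le_trans D Kba); rewrite le_eqVlt; apply/orP; left; apply/eqP.
    rewrite /stein_slope -/(hh x) -/f; congr (`|_|).
    by field; rewrite ?mulN1r ?mul1r ?nx1 ?nx1' ?x0.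
  have x10 : 0 < x - 1 by lra.
  have := core_sol_derive_le b0 a0 (or_introl erefl)
    (klipschitz_affine 1 (or_introl erefl)) h1L x10 (or_intror erefl).
  have -> : core_sol b a 1 (hh \o affine 1 1) (x - 1) = - f x.
    by rewrite /f (stein_sol_gt1 a b hL)// opprK.
  rewrite /= /affine (_ : 1 + 1 * (x - 1) = x); last by ring.
  move=> D; apply: le_trans (le_trans D Kba); rewrite le_eqVlt; apply/orP; left; apply/eqP.
  rewrite /stein_slope -/(hh x) -/f -normrN; congr (`|_|).
  by field; rewrite ?mulN1r ?mul1r ?nx1 ?nx1' ?x0.
Qed.

(** The values at 0 and 1 are those that the Stein equation forces there; by
    [core_sol_cvg0] they are also the limits. *)
Lemma continuous_stein_sol : continuous f.
Proof.
move=> x; have [->|x0] := eqVneq x 0.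
  pose C := (1 + 4 * (2 `^ b) ^+ 2 * (b + 2)) * L / a.
  have f0 : f 0 = hh 0 / a by rewrite /f /stein_sol ltxx eqxx.
  apply: (@continuous_at_le _ f 0 C) => t; rewrite subr0 => t2.
  have [tl|tg|->] := ltgtP t 0; last by rewrite subrr normr0 mulr0.
    rewrite (ltr0_norm tl) in t2 *; have nt0 : 0 < - t by rewrite oppr_gt0.
    have := core_sol_cvg0 a0 b0 (or_introl erefl)
      (klipschitz_affine 0 (or_intror erefl)) h0L' nt0 t2.
    by rewrite -(stein_sol_lt0 a b hL tl) f0 /= /affine mulr0 addr0.
  rewrite (gtr0_norm tg) in t2 *.
  have := core_sol_cvg0 a0 b0 (or_intror erefl)
    (klipschitz_affine 0 (or_introl erefl)) h0L tg t2.
  by rewrite -(stein_sol_left a0 b0 hL tg) ?f0 /= /affine ?mulr0 ?addr0//; lra.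
have [->|x1] := eqVneq x 1; last exact: is_derive1_continuous (is_derive1_stein_sol x0 x1).
pose C := (1 + 4 * (2 `^ a) ^+ 2 * (a + 2)) * L / b.
have f1 : f 1 = - (hh 1 / b).
  by rewrite /f /stein_sol ltNge ler01 /= oner_eq0 ltxx eqxx.
apply: (@continuous_at_le _ f 1 C) => t t2.
have [tl|tg|->] := ltgtP t 1; last by rewrite !subrr normr0 mulr0.
  rewrite (_ : `|t - 1| = 1 - t) in t2 *; last by rewrite distrC gtr0_norm ?subr_gt0.
  have nt0 : 0 < 1 - t by rewrite subr_gt0.
  have t0 : 0 < t by lra.
  have := core_sol_cvg0 b0 a0 (or_intror erefl)
    (klipschitz_affine 1 (or_intror erefl)) h1L' nt0 t2.
  rewrite (_ : core_sol _ _ _ _ _ = - f t) /= /affine; last first.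
    by rewrite /f (stein_sol_right a0 b0 hL)// opprK.
  rewrite mulr0 addr0 -/(hh 1) -[X in X <= _ -> _]normrN (_ : - (- f t - hh 1 / b) = f t - f 1)//.
  by rewrite f1; ring.
rewrite (gtr0_norm (_ : 0 < t - 1)) ?subr_gt0// in t2 *.
have nt0 : 0 < t - 1 by rewrite subr_gt0.
have := core_sol_cvg0 b0 a0 (or_introl erefl)
  (klipschitz_affine 1 (or_introl erefl)) h1L nt0 t2.
rewrite (_ : core_sol _ _ _ _ _ = - f t) /= /affine; last first.
  by rewrite /f (stein_sol_gt1 a b hL)// opprK.
rewrite mulr0 addr0 -/(hh 1) -[X in X <= _ -> _]normrN (_ : - (- f t - hh 1 / b) = f t - f 1)//.
by rewrite f1; ring.
Qed.

Lemma klipschitz_stein_sol : (stein_const1 a b * L).-lipschitz f.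
Proof.
apply: (@klipschitz_derive_except _ _ _ [:: 0; 1]); first exact: continuous_stein_sol.
move=> t; rewrite !inE negb_or => /andP[t0 t1].
have D := is_derive1_stein_sol t0 t1.
by rewrite (is_derive1E D); split; [case: D|exact: stein_slope_le].
Qed.

End stein_sol_regularity.

(** * The second-order bound *)

Section stein_solution_derivative.
Context {R : realType}.
Notation mu := (@lebesgue_measure R).
Implicit Types (a b x e : R) (h : R -> R).

(** The second derivative need not be continuous, so its essential supremum
    bounds the increments of [h'] by [klipschitz_ae_derive] and not by the mean
    value theorem. *)
Lemma twice_diff_bounded_norms h : twice_diff_bounded h ->
  exists L N : R, [/\ lip_norm h = L%:E, L.-lipschitz h,
    sup_norm h^`(2) = N%:E & N.-lipschitz h^`()].
Proof.
move=> [dh d2h [M [Mr hM]] [M2 [M2r hM2]]].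
have hlip : (M + 1).-lipschitz h.
  apply: (@klipschitz_derive_except _ _ _ [::]) => [x|t _].
    exact: is_derive1_continuous (derivable_is_derive1 (dh x)).
  by split; [exact: dh|apply: hM => //; rewrite ltrDl].
have h'lip : (M2 + 1).-lipschitz h^`().
  apply: (@klipschitz_derive_except _ _ _ [::]) => [x|t _].
    exact: is_derive1_continuous (derivable_is_derive1 (d2h x)).
  by split; [exact: d2h|apply: hM2 => //; rewrite ltrDl].
have [L LE hL] : exists2 L, lip_norm h = L%:E & L.-lipschitz h.
  by apply: lip_normP; apply/lipschitzP; exists (M + 1).
have [N NE N0] : exists2 N, sup_norm h^`(2) = N%:E & 0 <= N.
  by apply: (@sup_norm_fin _ _ (M2 + 1)) => x; apply: hM2 => //; rewrite ltrDl.
exists L, N; split => //.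
apply: (klipschitz_ae_derive h'lip).
have : (sup_norm h^`(2) <= N%:E)%E by rewrite NE.
by move=> /sup_normP; apply: ae_imply => x hx; split; [exact: d2h|exact: hx].
Qed.

Lemma is_derive1_normr_powR a (x : R) : x != 0 ->
  is_derive x 1 (fun t : R => `|t| `^ a) (a / x * `|x| `^ a).
Proof.
move=> x0; have [xl|xg|xe] := ltgtP x 0; last by rewrite xe eqxx in x0.
  have nx0 : 0 < 0 + -1 * x by lra.
  have D := is_derive1_affine_comp (is_derive1_powR a nx0).
  apply: (@is_derive1_near _ (fun t => (0 + -1 * t) `^ a)).
    near=> t; rewrite ltr0_norm ?add0r ?mulN1r//.
    by near: t; exact: lt_nbhsl.
  apply: (is_derive1_eq D); rewrite add0r mulN1r in nx0 *.
  rewrite (ltr0_norm xl) powRB; last by rewrite (gt_eqF nx0) implybT.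
  by rewrite powRr1 ?(ltW nx0)//; field.
apply: (@is_derive1_near _ (fun t => t `^ a)).
  by near=> t; rewrite gtr0_norm//; near: t; exact: lt_nbhsr.
apply: (is_derive1_eq (is_derive1_powR a xg)).
rewrite (gtr0_norm xg) powRB; last by rewrite (gt_eqF xg) implybT.
by rewrite powRr1 ?(ltW xg)//; field.
Unshelve. all: by end_near. Qed.

Lemma near_neq x e : x != e -> \forall t \near x, t != e.
Proof.
move=> xe; have [xl|xg|ee] := ltgtP x e; last by rewrite ee eqxx in xe.
  by near=> t; rewrite lt_eqF//; near: t; exact: lt_nbhsl.
by near=> t; rewrite gt_eqF//; near: t; exact: lt_nbhsr.
Unshelve. all: by end_near. Qed.

Section identification.
Variables (a b L N : R) (h : R -> R).
Hypotheses (a0 : 0 < a) (b0 : 0 < b) (hL : L.-lipschitz h).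
Hypotheses (dh : forall x, derivable h x 1) (hN : N.-lipschitz h^`()).

Let f := stein_sol a b h.
Let u := stein_slope a b h.

(** Right-hand side of the equation obtained by differentiating the Stein
    equation: [x (1 - x) f'' + ((a + 1) - (a + b + 2) x) f'] equals
    [h' + (a + b) f]. *)
Definition stein_next x : R := h^`()%classic x + (a + b) * stein_sol a b h x.

Definition stein_const2 : R :=
  stein_const1 (a + 1) (b + 1) * (1 + (a + b) * stein_const1 a b).

Let L2 := N + (a + b) * (stein_const1 a b * L).

Lemma klipschitz_stein_next : L2.-lipschitz stein_next.
Proof.
apply/klipschitzP => x y; rewrite /stein_next /L2.
rewrite (_ : _ - _ = (h^`()%classic x - h^`()%classic y) + (a + b) * (f x - f y)); last first.
  by rewrite mulrBr opprD addrACA.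
apply: le_trans (ler_normD _ _) _; rewrite [leRHS]mulrDl; apply: lerD.
  exact: (klipschitzP _ _).1 hN x y.
rewrite normrM gtr0_norm ?addr_gt0// -mulrA ler_wpM2l ?addr_ge0 ?(ltW a0) ?(ltW b0)//.
exact: (klipschitzP _ _).1 (klipschitz_stein_sol a0 b0 hL) x y.
Qed.

Let a1 : 0 < a + 1. Proof. by rewrite addr_gt0. Qed.
Let b1 : 0 < b + 1. Proof. by rewrite addr_gt0. Qed.

Let F := stein_sol (a + 1) (b + 1) stein_next.
Let m := beta_mean (a + 1) (b + 1) stein_next.

Lemma is_derive1_stein_slope x : x != 0 -> x != 1 ->
  is_derive x 1 u
    ((stein_next x - (a + 1 - (a + 1 + (b + 1)) * x) * u x) / (x * (1 - x))).
Proof.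
move=> x0 x1; have nx1 : 1 - x != 0 by rewrite subr_eq0 eq_sym.
have dhx := derivable_is_derive1 (@dh x).
have dfx := is_derive1_stein_sol a0 b0 hL x0 x1.
have dl : is_derive x 1 (fun t => a - (a + b) * t) (- (a + b)).
  have := is_derive1_affine a (- (a + b)) x.
  by under eq_fun do rewrite mulNr.
have dq : is_derive x 1 (fun t => t * (1 - t)) (1 - 2 * x).
  have d1 : is_derive x 1 (fun t => 1 - t) (-1 : R).
    by have := is_derive1_affine 1 (-1) x; under eq_fun do rewrite mulN1r.
  apply: (is_derive1_eq (is_derive1M (is_derive_id x 1) d1)).
  by ring.
have dn := is_derive1B (is_derive1B dhx (is_derive_cst (beta_mean a b h) x 1))
  (is_derive1M dl dfx).
have qx0 : x * (1 - x) != 0 by rewrite mulf_neq0.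
have := is_derive1M dn (@is_derive1V _ (fun t => t * (1 - t)) x _ qx0 dq).
move=> /is_derive1_eq; apply.
rewrite /stein_next /u /stein_slope -/(f x) /cst.
by field; rewrite ?nx1 ?x0.
Qed.

Let W (x : R) := `|x| `^ (a + 1) * `|1 - x| `^ (b + 1).

Let is_derive1_W x : x != 0 -> x != 1 ->
  is_derive x 1 W (((a + 1) / x - (b + 1) / (1 - x)) * W x).
Proof.
move=> x0 x1; have nx1 : 1 - x != 0 by rewrite subr_eq0 eq_sym.
have := is_derive1_normr_powR (b + 1) nx1.
rewrite -[X in is_derive X](_ : 1 + -1 * x = 1 - x); last by rewrite mulN1r.
move=> /is_derive1_affine_comp; under eq_fun do rewrite mulN1r.
move=> d1; have := is_derive1M (is_derive1_normr_powR (a + 1) x0) d1.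
move=> /is_derive1_eq; apply; rewrite /W.
by ring.
Qed.

(** [u] and [F] solve the same equation up to the constant [m]; multiplying their
    difference by the integrating factor [W] of the homogeneous equation leaves
    a function whose derivative is explicit. *)
Let Q x := W x * (u x - F x).

Let is_derive1_Q x : x != 0 -> x != 1 ->
  is_derive x 1 Q (W x * (m / (x * (1 - x)))).
Proof.
move=> x0 x1; have nx1 : 1 - x != 0 by rewrite subr_eq0 eq_sym.
have dF := is_derive1_stein_sol a1 b1 klipschitz_stein_next x0 x1.
have := is_derive1M (is_derive1_W x0 x1) (is_derive1B (is_derive1_stein_slope x0 x1) dF).
move=> /is_derive1_eq; apply.
rewrite [stein_slope (a + 1) _ _ _]/stein_slope -/m -/(F x).
by field; rewrite ?nx1 ?x0.
Qed.

Let W_le x e : e = 0 \/ e = 1 -> `|x - e| <= 2^-1 ->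
  W x <= 2 `^ (a + b + 1) * `|x - e|.
Proof.
have aux (c d v w : R) : 0 < c -> 0 < d -> 0 <= v -> v <= 2^-1 -> 0 <= w -> w <= 2 ->
    v `^ (c + 1) * w `^ (d + 1) <= 2 `^ (c + d + 1) * v.
  move=> c0 d0 v0 v2 w0 w2; rewrite mulrC ler_pM ?powR_ge0//.
    apply: (@le_trans _ _ (2 `^ (d + 1))); first by apply: le_powRl => //; lra.
    by apply: ler_powR; lra.
  move: v0; rewrite le_eqVlt => /predU1P[<-|v0]; first by rewrite powR0//; lra.
  by apply: ge1r_powR; [apply/andP; split|]; lra.
case=> -> xe; rewrite /W.
  rewrite subr0 in xe *; apply: aux => //.
  by apply: le_trans (ler_normB _ _) _; rewrite normr1; lra.
rewrite (distrC x 1) in xe *; rewrite (_ : a + b + 1 = b + a + 1); last by ring.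
rewrite (mulrC (`|x| `^ (a + 1))); apply: (aux b a) => //.
rewrite (_ : x = 1 - (1 - x)); last by ring.
apply: le_trans (ler_normB _ _) _; rewrite normr1; lra.
Qed.

(** The exponents [a + 1] and [b + 1] exceed 1, so [W] vanishes at 0 and 1 at
    least linearly, while [u] and [F] stay bounded. *)
Let Q_continuous : continuous Q.
Proof.
have Q01 e : e = 0 \/ e = 1 -> {for e, continuous Q}.
  move=> eE.
  pose K := stein_const1 a b * L.
  pose K2 := stein_const1 (a + 1) (b + 1) * L2.
  have Qe : Q e = 0.
    rewrite /Q /W; case: eE => ->; first by rewrite normr0 powR0 ?mul0r// gt_eqF.
    by rewrite subrr normr0 powR0 ?mulr0 ?mul0r// gt_eqF.
  apply: (@continuous_at_le _ Q e (2 `^ (a + b + 1) * (K + (`|F e| + K2)))) => x xe.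
  rewrite Qe subr0; have [->|xe0] := eqVneq x e; first by rewrite Qe subrr normr0 mulr0.
  have x0 : x != 0.
    case: eE xe xe0 => -> // xe _; apply: contraTneq xe => ->.
    by rewrite sub0r normrN normr1 -ltNge; lra.
  have x1 : x != 1.
    case: eE xe xe0 => -> // xe _; apply: contraTneq xe => ->.
    by rewrite subr0 normr1 -ltNge; lra.
  have ux := stein_slope_le a0 b0 hL x0 x1.
  have K20 : 0 <= K2 by exact: klipschitz_ge0 (klipschitz_stein_sol a1 b1 klipschitz_stein_next).
  have Fx : `|F x| <= `|F e| + K2.
    rewrite -[F x](subrKC (F e)).
    apply: le_trans (ler_normD _ _) _; rewrite lerD2l.
    apply: le_trans ((klipschitzP _ _).1 (klipschitz_stein_sol a1 b1 klipschitz_stein_next) x e) _.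
    by rewrite ler_piMr//; lra.
  have W0 : 0 <= W x by rewrite mulr_ge0 ?powR_ge0.
  rewrite /Q normrM (ger0_norm W0) [leRHS]mulrAC ler_pM//.
    exact: W_le.
  exact: le_trans (ler_normB _ _) (lerD ux Fx).
move=> x; have [->|x0] := eqVneq x 0; first by apply: Q01; left.
have [->|x1] := eqVneq x 1; first by apply: Q01; right.
exact: is_derive1_continuous (is_derive1_Q x0 x1).
Qed.

Let Q0 : Q 0 = 0.
Proof. by rewrite /Q /W normr0 powR0 ?mul0r// gt_eqF. Qed.

Let Q1 : Q 1 = 0.
Proof. by rewrite /Q /W subrr normr0 powR0 ?mulr0 ?mul0r// gt_eqF. Qed.

Let W_gt0 x : x != 0 -> x != 1 -> 0 < W x.
Proof.
move=> x0 x1; rewrite /W mulr_gt0 ?powR_gt0 ?normr_gt0//.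
by rewrite subr_eq0 eq_sym.
Qed.

(** [Q] vanishes at 0 and 1, hence so does its derivative somewhere in between;
    but this derivative has the sign of [m] throughout the interval. *)
Lemma beta_mean_stein_next : m = 0.
Proof.
have [||||c] := @Rolle R Q 0 1.
- exact: ltr01.
- move=> x; rewrite in_itv/= => /andP[x0 x1].
  have x1' : x != 1 by rewrite lt_eqF.
  by have [] := is_derive1_Q (lt0r_neq0 x0) x1'.
- exact: continuous_subspaceT.
- by rewrite Q0 Q1.
rewrite in_itv/= => /andP[c0 c1] dQ0.
have c0' := lt0r_neq0 c0; have c1' : c != 1 by rewrite lt_eqF.
have := is_derive1E (is_derive1_Q c0' c1'); rewrite (is_derive1E dQ0).
move=> /esym/eqP; rewrite mulf_eq0 (gt_eqF (W_gt0 c0' c1'))/=.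
rewrite mulf_eq0 invr_eq0 mulf_eq0 subr_eq0 (eq_sym 1).
by rewrite (negbTE c0') (negbTE c1')/= orbF => /eqP.
Qed.

(** As [m = 0], the derivative of [Q] vanishes outside 0 and 1, so [Q] is
    constant, by continuity equal to its value 0 at 0. *)
Lemma stein_slope_next x : x != 0 -> x != 1 -> u x = F x.
Proof.
move=> x0 x1.
have : 0.-lipschitz Q.
  apply: (@klipschitz_derive_except _ _ _ [:: 0; 1]); first exact: Q_continuous.
  move=> t; rewrite !inE negb_or => /andP[t0 t1].
  have D := is_derive1_Q t0 t1; rewrite (is_derive1E D) beta_mean_stein_next.
  by split; [case: D|rewrite mul0r mulr0 normr0].
move=> /klipschitzP/(_ x 0); rewrite Q0 subr0 mul0r normr_le0 /Q mulf_eq0.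
by rewrite gt_eqF ?W_gt0//= subr_eq0 => /eqP.
Qed.

Lemma derive1_stein_sol x : x != 0 -> x != 1 -> f^`() x = F x.
Proof.
move=> x0 x1; rewrite (is_derive1E (is_derive1_stein_sol a0 b0 hL x0 x1)).
exact: stein_slope_next.
Qed.

Lemma is_derive1_derive_stein_sol x : x != 0 -> x != 1 ->
  is_derive x 1 f^`() (F^`() x).
Proof.
move=> x0 x1; apply: (@is_derive1_near _ F).
  near=> t; apply/esym/derive1_stein_sol.
    by near: t; exact: near_neq.
  by near: t; exact: near_neq.
have [dF _] := is_derive1_stein_sol a1 b1 klipschitz_stein_next x0 x1.
exact: derivable_is_derive1.
Unshelve. all: by end_near. Qed.

End identification.

(** The second derivative of the solution is the first derivative of another
    Stein solution, to which the first-order bound applies. *)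
Theorem stein_bounds_const a b : 0 < a -> 0 < b ->
  stein_bounds a b (stein_const1 a b) (stein_const2 a b).
Proof.
move=> a0 b0; split=> h.
  move=> /lip_normP[L -> hL] f; split.
    apply: ae_imply (ae_notin [:: 0; 1]) => x; rewrite !inE negb_or => /andP[x0 x1].
    by have [] := is_derive1_stein_sol a0 b0 hL x0 x1.
  rewrite -EFinM; apply/sup_normP.
  apply: ae_imply (ae_notin [:: 0; 1]) => x; rewrite !inE negb_or => /andP[x0 x1].
  have D := is_derive1_stein_sol a0 b0 hL x0 x1.
  by rewrite (is_derive1E D); exact: stein_slope_le.
move=> hd; have [dh d2h _ _] := hd.
have [L [N [LE hL NE hN]]] := twice_diff_bounded_norms hd.
have -> : (lip_norm h + sup_norm h^`(2))%E = (L + N)%:E by rewrite LE NE.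
move=> f; split.
  apply: ae_imply (ae_notin [:: 0; 1]) => x; rewrite !inE negb_or => /andP[x0 x1].
  split; first by have [] := is_derive1_stein_sol a0 b0 hL x0 x1.
  by have [] := is_derive1_derive_stein_sol a0 b0 hL dh hN x0 x1.
rewrite -EFinM; apply/sup_normP.
apply: ae_imply (ae_notin [:: 0; 1]) => x; rewrite !inE negb_or => /andP[x0 x1].
have -> : f^`(2) x = f^`()^`() x by [].
rewrite (is_derive1E (is_derive1_derive_stein_sol a0 b0 hL dh hN x0 x1)).
have a1 : 0 < a + 1 by rewrite addr_gt0.
have b1 : 0 < b + 1 by rewrite addr_gt0.
have hn := klipschitz_stein_next a0 b0 hL hN.
rewrite (is_derive1E (is_derive1_stein_sol a1 b1 hn x0 x1)).
apply: le_trans (stein_slope_le a1 b1 hn x0 x1) _.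
rewrite /stein_const2 -mulrA.
have K0 : 0 <= stein_const1 a b by rewrite addr_ge0 ?core_const_ge0.
have K1 : 0 <= stein_const1 (a + 1) (b + 1) by rewrite addr_ge0 ?core_const_ge0.
apply: ler_wpM2l => //.
have L0 := klipschitz_ge0 hL; have N0 := klipschitz_ge0 hN.
have ab : 0 <= a + b by rewrite addr_ge0 ?ltW.
have t1 : 0 <= (a + b) * (stein_const1 a b * N) by rewrite !mulr_ge0.
move: (stein_const1 a b) K0 t1 => K K0 t1; move: (a + b) ab t1 => c c0 t1.
rewrite -subr_ge0 (_ : _ - _ = L + c * (K * N)); last by ring.
exact: addr_ge0.
Qed.

End stein_solution_derivative.

(** * Taylor bounds *)

Section taylor.
Context {R : realType}.
Implicit Types (f F G : R -> R) (B x t : R).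

Lemma is_derive1_pow2 B x t :
  is_derive t 1 (fun u => B / 2 * (u - x) ^+ 2) (B * (t - x)).
Proof.
have d1 : is_derive t 1 (fun u : R => u - x) 1.
  apply: (is_derive1_eq (is_derive1B (is_derive_id t 1) (is_derive_cst x t 1))).
  by rewrite subr0.
have := is_derive1Ml (B / 2) (is_derive1M d1 d1).
by move=> /is_derive1_eq; apply; field.
Qed.

Lemma is_derive1_pow3 B x t :
  is_derive t 1 (fun u => B / 6 * (u - x) ^+ 3) (B / 2 * (t - x) ^+ 2).
Proof.
have d1 : is_derive t 1 (fun u : R => u - x) 1.
  apply: (is_derive1_eq (is_derive1B (is_derive_id t 1) (is_derive_cst x t 1))).
  by rewrite subr0.
have := is_derive1Ml (B / 6) (is_derive1M d1 (is_derive1M d1 d1)).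
by move=> /is_derive1_eq; apply; field.
Qed.

Lemma is_derive1_linear k x t : is_derive t 1 (fun u : R => k * (u - x)) k.
Proof.
apply: (is_derive1_eq (is_derive1Ml k (is_derive1B (is_derive_id t 1) (is_derive_cst x t 1)))).
by rewrite subr0 mulr1.
Qed.

Variables (f F : R -> R) (B : R) (s : seq R).
Hypotheses (cf : continuous f) (FB : B.-lipschitz F).
Hypothesis df : forall t, t \notin s -> is_derive t 1 f (F t).

Let B0 : 0 <= B. Proof. exact: klipschitz_ge0 FB. Qed.

Lemma taylor1 x t : `|f t - f x - F x * (t - x)| <= B / 2 * (t - x) ^+ 2.
Proof.
pose phi u := f u - F x * (u - x).
have cphi D : {within D, continuous phi}.
  apply: continuous_subspaceT => u; apply: cvgB; first exact: cf.
  exact: is_derive1_continuous (is_derive1_linear (F x) x u).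
have dphi u : u \notin s -> is_derive u 1 phi (F u - F x).
  by move=> us; exact: is_derive1B (df us) (is_derive1_linear (F x) x u).
have phiE : f t - f x - F x * (t - x) = phi t - phi x by rewrite /phi; ring.
rewrite phiE; have [xt|/ltW tx] := leP x t.
  have := @mean_value_majorant R phi _ _ s x t xt (cphi _) (is_derive1_pow2 B x).
  rewrite subrr expr0n/= mulr0 subr0; apply => u; rewrite in_itv/= => /andP[xu ut] us.
  have D := dphi u us; rewrite (is_derive1E D); split; first by case: D.
  apply: le_trans ((klipschitzP _ _).1 FB u x) _.
  by rewrite gtr0_norm ?subr_gt0.
have := @mean_value_majorant R phi _ _ s t x tx (cphi _) (is_derive1_pow2 (- B) x).
rewrite subrr expr0n/= mulr0 sub0r !mulNr opprK distrC; apply => u.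
rewrite in_itv/= => /andP[tu ux] us.
have D := dphi u us; rewrite (is_derive1E D); split; first by case: D.
apply: le_trans ((klipschitzP _ _).1 FB u x) _.
by rewrite ltr0_norm ?subr_lt0// mulrN mulNr.
Qed.

Lemma taylor2 G (c d x t : R) :
  (forall u, u \in `]c, d[%R -> is_derive u 1 G (f u)) ->
  x \in `]c, d[%R -> t \in `]c, d[%R ->
  `|G t - G x - f x * (t - x) - F x / 2 * (t - x) ^+ 2| <= B / 6 * `|t - x| ^+ 3.
Proof.
rewrite !in_itv/= => dG /andP[cx xd] /andP[ct td].
pose phi u := G u - f x * (u - x) - F x / 2 * (u - x) ^+ 2.
have dphi u : c < u -> u < d -> is_derive u 1 phi (f u - f x - F x * (u - x)).
  move=> cu ud; apply: is_derive1B; last exact: is_derive1_pow2.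
  apply: is_derive1B; last exact: is_derive1_linear.
  by apply: dG; rewrite in_itv/= cu.
have cphi p q : c < p -> q < d -> {within `[p, q], continuous phi}.
  move=> cp qd; apply: continuous_in_subspaceT => u.
  rewrite inE/= in_itv/= => /andP[pu uq].
  exact: is_derive1_continuous (dphi _ (lt_le_trans cp pu) (le_lt_trans uq qd)).
have -> : G t - G x - f x * (t - x) - F x / 2 * (t - x) ^+ 2 = phi t - phi x.
  by rewrite /phi; ring.
have [xt|/ltW tx] := leP x t.
  have := @mean_value_majorant R phi _ _ [::] x t xt (cphi _ _ cx td) (is_derive1_pow3 B x).
  rewrite subrr expr0n/= mulr0 subr0 (ger0_norm (_ : 0 <= t - x)) ?subr_ge0//; apply => u.
  rewrite in_itv/= => /andP[xu ut] _.
  have D := dphi u (lt_trans cx xu) (lt_trans ut td); rewrite (is_derive1E D).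
  by split; [case: D|exact: taylor1].
have := @mean_value_majorant R phi _ _ [::] t x tx (cphi _ _ ct xd) (is_derive1_pow3 B x).
rewrite subrr expr0n/= mulr0 sub0r.
rewrite (_ : - (B / 6 * (t - x) ^+ 3) = B / 6 * `|t - x| ^+ 3); last first.
  by rewrite ler0_norm ?subr_le0//; ring.
rewrite distrC; apply => u; rewrite in_itv/= => /andP[tu ux] _.
have D := dphi u (lt_trans ct tu) (lt_trans ux xd); rewrite (is_derive1E D).
by split; [case: D|exact: taylor1].
Qed.

End taylor.

(** * Comparison of the Stein operator with a birth and death chain *)

Section stein_discretisation.
Context {R : realType}.
Notation mu := (@lebesgue_measure R).
Implicit Types (a b : R) (h : R -> R) (n k : nat).

(** Rates of a chain on {0, ..., n} whose reversible law is that of the number of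
    red draws. *)
Definition birth a n k : R := (n - k)%:R * (a + k%:R).
Definition death b n k : R := k%:R * (b + (n - k)%:R).

Definition stein_rate a b A B n : R :=
  (A * ((`|a - b| + a) / 2) + B * (6^-1 + (a + b - 1) / (6 * n%:R))) / n%:R.

(** With step [dl = 1 / n] and [x = k / n], the expansions of [G] at [x] contribute
    [dl * (birth - death) = a - (a + b) x] times [f x] and
    [dl ^ 2 / 2 * (birth + death) = x (1 - x) + dl / 2 * (a (1 - x) + b x)] times
    [F x]; the remainders are at most [B / 6 * dl ^ 3 * (birth + death)]. *)
Lemma birth_death_step a b A B n k (x : R) (f F G : R -> R) : x = k%:R / n%:R ->
  0 < a -> 0 < b -> (0 < n)%N -> (k <= n)%N ->
  0 <= B -> `|F x| <= A ->
  (forall x t, 0 <= x -> x <= 1 -> 0 <= t -> t <= 1 ->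
    `|G t - G x - f x * (t - x) - F x / 2 * (t - x) ^+ 2| <= B / 6 * `|t - x| ^+ 3) ->
  `|x * (1 - x) * F x + (a - (a + b) * x) * f x -
    (birth a n k * (G (k.+1%:R / n%:R) - G x) -
     death b n k * (G x - G (k.-1%:R / n%:R)))| <= stein_rate a b A B n.
Proof.
move=> xE a0 b0 n0 kn B0 FA T.
have nR0 : 0 < n%:R :> R by rewrite ltr0n.
have nR1 : 1 <= n%:R :> R by rewrite ler1n.
pose K : R := k%:R; pose M : R := (n - k)%:R.
have K0 : 0 <= K by rewrite ler0n.
have M0 : 0 <= M by rewrite ler0n.
have nE : n%:R = M + K by rewrite -natrD subnK.
have x0 : 0 <= x by rewrite xE divr_ge0// ltW.
have x1 : x <= 1 by rewrite xE ler_pdivrMr// mul1r ler_nat.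
pose dl : R := n%:R^-1.
have dl0 : 0 < dl by rewrite invr_gt0.
have dl1 : dl <= 1 by rewrite invf_le1.
(* Taylor remainders of a birth and of a death *)
pose U := G (k.+1%:R / n%:R) - G x - f x * dl - F x / 2 * dl ^+ 2.
pose V := G (k.-1%:R / n%:R) - G x + f x * dl - F x / 2 * dl ^+ 2.
have lamU : `|birth a n k * U| <= birth a n k * (B / 6 * dl ^+ 3).
  have lam0 : 0 <= birth a n k by rewrite mulr_ge0// addr_ge0// ltW.
  rewrite normrM (ger0_norm lam0).
  have [kn'|kn'] := eqVneq k n; first by rewrite /birth kn' subnn !mul0r.
  rewrite ler_wpM2l//.
  have := T x (k.+1%:R / n%:R) x0 x1.
  have -> : k.+1%:R / n%:R - x = dl by rewrite xE -mulrBl -natrB// subSnn mul1r.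
  rewrite (gtr0_norm dl0); apply; first by rewrite divr_ge0// ltW.
  by rewrite ler_pdivrMr// mul1r ler_nat ltn_neqAle kn' kn.
have muV : `|death b n k * V| <= death b n k * (B / 6 * dl ^+ 3).
  have mu0 : 0 <= death b n k by rewrite mulr_ge0// addr_ge0// ltW.
  rewrite normrM (ger0_norm mu0).
  have [k0|k0] := posnP k; first by rewrite /death k0 !mul0r.
  rewrite ler_wpM2l//.
  have := T x (k.-1%:R / n%:R) x0 x1.
  have -> : k.-1%:R / n%:R - x = - dl.
    by rewrite xE -mulrBl -{2}(prednK k0) -natr1 opprD addNKr mulN1r.
  rewrite normrN (gtr0_norm dl0) mulrN opprK sqrrN; apply; first by rewrite divr_ge0// ltW.
  by rewrite ler_pdivrMr// mul1r ler_nat (leq_trans (leq_pred _)).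
have KE : K = x * n%:R by rewrite xE divfK// gt_eqF.
have ndl : n%:R * dl = 1 by rewrite mulfV// gt_eqF.
have ME : M = (1 - x) * n%:R by rewrite mulrBl mul1r -KE nE addrK.
have -> : x * (1 - x) * F x + (a - (a + b) * x) * f x -
    (birth a n k * (G (k.+1%:R / n%:R) - G x) -
     death b n k * (G x - G (k.-1%:R / n%:R))) =
    - (birth a n k * U) - death b n k * V - (a * (1 - x) + b * x) * F x / 2 * dl.
  rewrite /U /V; move: (G _) (G _) (G x) => g1 g2 g0.
  rewrite /birth /death -/K -/M KE ME.
  have -> : n%:R = dl^-1 :> R by rewrite /dl invrK.
  by field; rewrite gt_eqF.
apply: le_trans (ler_normB _ _) _.
apply: le_trans (lerD (ler_normB _ _) (lexx _)) _.
rewrite normrN.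
apply: le_trans (lerD (lerD lamU muV) (lexx _)) _.
have absum : `|(a * (1 - x) + b * x) * F x / 2 * dl| <= A * ((`|a - b| + a) / 2) * dl.
  have cle : `|a * (1 - x) + b * x| <= `|a - b| + a.
    have -> : a * (1 - x) + b * x = a - (a - b) * x by ring.
    apply: le_trans (ler_normB _ _) _; rewrite addrC (gtr0_norm a0) lerD2r.
    by rewrite normrM (ger0_norm x0) ler_piMr.
  have h0 : 0 < 2^-1 :> R by [].
  rewrite normrM (gtr0_norm dl0) ler_wpM2r ?(ltW dl0)//.
  rewrite normrM (gtr0_norm h0) [leRHS]mulrA ler_wpM2r ?(ltW h0)//.
  by rewrite normrM [leRHS]mulrC ler_pM.
(* At n = 1 this uses that [x] is a multiple of [1 / n]: it is 0 or 1. *)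
have xx : 2 * (x * (1 - x)) <= 1 - dl.
  have [n1|n1] := leqP n 1.
    have n1' : n = 1%N by apply/eqP; rewrite eqn_leq n1 n0.
    have dl1' : dl = 1 by rewrite /dl n1' invr1.
    rewrite dl1' subrr; move: kn; rewrite n1' leq_eqVlt ltnS leqn0 => /orP[] /eqP kk.
      by rewrite (_ : x = 1) ?subrr ?mulr0// xE kk n1' divr1.
    by rewrite (_ : x = 0) ?mul0r ?mulr0// xE kk mul0r.
  have dl2 : dl <= 2^-1 by rewrite lef_pV2 ?posrE// ler_nat.
  have := sqr_ge0 (x - 2^-1); nra.
have abx : a * (1 - x) + b * x <= a + b.
  have ax : a * (1 - x) <= a by rewrite ler_piMr ?(ltW a0)//; lra.
  have bx : b * x <= b by rewrite ler_piMr ?(ltW b0).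
  exact: lerD.
have sumle : birth a n k * (B / 6 * dl ^+ 3) + death b n k * (B / 6 * dl ^+ 3) <=
    B * (6^-1 + (a + b - 1) / (6 * n%:R)) * dl.
  have -> : birth a n k * (B / 6 * dl ^+ 3) + death b n k * (B / 6 * dl ^+ 3) =
      B / 6 * dl * (2 * (x * (1 - x)) + (a * (1 - x) + b * x) * dl).
    rewrite /birth /death -/K -/M KE ME.
    have -> : n%:R = dl^-1 :> R by rewrite /dl invrK.
    by field; rewrite gt_eqF.
  have -> : B * (6^-1 + (a + b - 1) / (6 * n%:R)) * dl =
      B / 6 * dl * ((1 - dl) + (a + b) * dl).
    have -> : n%:R = dl^-1 :> R by rewrite /dl invrK.
    by field; rewrite gt_eqF.
  rewrite ler_wpM2l//; first by rewrite mulr_ge0 ?divr_ge0// ltW.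
  by rewrite lerD// ler_wpM2r// ltW.
apply: le_trans (lerD sumle absum) _.
by rewrite /stein_rate [leRHS]mulrDl addrC.
Qed.

End stein_discretisation.

(** * Draws from the urn *)

Section polya_histories.
Context (d : measure_display) (T : measurableType d) (R : realType).
Variables (P : probability T R) (D : nat -> {RV P >-> bool}).

Definition history_prob (n : nat) (s : seq bool) : R :=
  fine (P [set t | history D n t = s]).

Lemma historyS n t : history D n.+1 t = rcons (history D n t) (D n.+1 t).
Proof.
have iotaS : iota 1 n.+1 = rcons (iota 1 n) n.+1.
  by rewrite -[in LHS](addn1 n) iotaD cats1.
by rewrite /history iotaS map_rcons.
Qed.

Lemma size_history n t : size (history D n t) = n.
Proof. by rewrite size_map size_iota. Qed.

Lemma measurable_draw n : measurable [set t | D n t].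
Proof.
rewrite (_ : [set t | D n t] = D n @^-1` [set true]).
  exact: measurable_funPTI.
by apply/seteqP; split => t /=; case: (D n t).
Qed.

Lemma history_rcons n s c :
  [set t | history D n.+1 t = rcons s c] =
  [set t | history D n t = s] `&` [set t | D n.+1 t = c].
Proof.
apply/seteqP; split => t /=; rewrite historyS; first by move=> /rcons_inj[].
by move=> [-> ->].
Qed.

Lemma measurable_history n s : measurable [set t | history D n t = s].
Proof.
elim: n s => [|n IHn] s.
  have [->|s0] := eqVneq s [::].
    by rewrite (_ : [set _ | _] = setT)//; apply/seteqP; split.
  rewrite (_ : [set _ | _] = set0)//; apply/seteqP; split => t //= h.
  by move: s0; rewrite -h.
case/lastP: s => [|s c].
  by rewrite (_ : [set _ | _] = set0)//; apply/seteqP; split.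
rewrite history_rcons; apply: measurableI => //.
case: c; first by have := measurable_draw n.+1.
rewrite (_ : [set t | D n.+1 t = false] = ~` [set t | D n.+1 t]).
  by apply: measurableC; exact: measurable_draw.
by apply/seteqP; split => t /=; case: (D n.+1 t).
Qed.

Lemma history_prob_ge0 n s : 0 <= history_prob n s.
Proof. by rewrite fine_ge0. Qed.

Lemma history_probE n s : (history_prob n s)%:E = P [set t | history D n t = s].
Proof. by rewrite fineK// fin_num_measure//; exact: measurable_history. Qed.

Lemma red_countE n t : red_count D n t = (count id (history D n t))%:R.
Proof.
elim: n => [|n IHn]; first by rewrite /red_count big_geq.
rewrite historyS -cats1 count_cat natrD -IHn /red_count big_nat_recr//=.
congr (_ + _); rewrite /red_draw indicE addn0.
by case Dt: (D n.+1 t); [rewrite mem_set|rewrite memNset//= Dt].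
Qed.

(** A finite sum over histories, which makes the recursion over the number of
    draws purely algebraic. *)
Definition count_expectation (n : nat) (phi : nat -> R) : R :=
  \sum_(s : n.-tuple bool) history_prob n s * phi (count id s).

Lemma expectation_red_freq n (h : R -> R) :
  ('E_P[h \o red_freq D n])%E =
  (count_expectation n (fun k => h (k%:R / n%:R)))%:E.
Proof.
rewrite unlock.
transitivity (\int[P]_t (\sum_(s : n.-tuple bool)
    (h ((count id s)%:R / n%:R))%:E * (\1_[set t | history D n t = s] t)%:E))%E.
  apply: eq_integral => t _ /=.
  have sz : size (history D n t) == n by rewrite size_history.
  rewrite (bigD1 (Tuple sz))//= big1 => [|s sD].
    rewrite adde0 indicE mem_set// mule1 /red_freq red_countE.
    by rewrite mulrC.
  rewrite indicE memNset ?mule0// => /= hs; move: sD => /eqP; apply.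
  exact: val_inj.
have intI s : P.-integrable setT (fun t => (\1_[set t | history D n t = s] t)%:E).
  by apply: integrable_indic; exact: measurable_history.
rewrite integral_sum//; last by move=> s; exact: integrableZl.
rewrite /count_expectation -sumEFin; apply: eq_bigr => s _.
rewrite integralZl// integral_indic//; last exact: measurable_history.
by rewrite setIT EFinM history_probE muleC.
Qed.

Lemma big_tuple_rcons n (F : seq bool -> R) :
  \sum_(s : n.+1.-tuple bool) F s =
  \sum_(s : n.-tuple bool) (F (rcons s true) + F (rcons s false)).
Proof.
have bij : bijective (fun p : n.-tuple bool * bool => [tuple of rcons p.1 p.2]).
  apply: inj_card_bij.
    move=> [s c] [s' c'] /(congr1 val)/= /rcons_inj[ss ->].
    by congr (_, _); exact: val_inj.
  by rewrite card_prod !card_tuple card_bool expnSr.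
rewrite (reindex (fun p : n.-tuple bool * bool => [tuple of rcons p.1 p.2]))/=; last exact: onW_bij.
rewrite -(pair_big xpredT xpredT (fun (s : n.-tuple bool) c => F (rcons s c)))/=.
by apply: eq_bigr => s _; rewrite big_bool.
Qed.

Variables (r w c : nat).
Hypotheses (r0 : (0 < r)%N) (w0 : (0 < w)%N) (c0 : (0 < c)%N).
Hypothesis urnD : polya_urn r w c D.

Let a : R := r%:R / c%:R.
Let b : R := w%:R / c%:R.

Let a0 : 0 < a. Proof. by rewrite divr_gt0 ?ltr0n. Qed.
Let b0 : 0 < b. Proof. by rewrite divr_gt0 ?ltr0n. Qed.

Let total_gt0 n : 0 < a + b + n%:R.
Proof. by rewrite ltr_wpDr ?addr_gt0. Qed.

Lemma red_proportion n (s : n.-tuple bool) :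
  (urn_red r c s)%:R / (urn_red r c s + urn_white w c s)%:R =
  (a + (count id s)%:R) / (a + b + n%:R) :> R.
Proof.
have sn : (count id s + count negb s = n)%N.
  by have := count_predC id s; rewrite size_tuple.
rewrite /urn_red /urn_white addnACA -mulnDr sn !natrD !natrM.
have c0' : c%:R != 0 :> R by rewrite pnatr_eq0 -lt0n.
have t0 : r%:R + w%:R + c%:R * n%:R != 0 :> R.
  by rewrite -natrM -!natrD pnatr_eq0 -lt0n !addn_gt0 r0.
by rewrite /a /b; field; rewrite c0' (mulrC n%:R).
Qed.

Lemma history_prob_true n (s : n.-tuple bool) :
  history_prob n.+1 (rcons s true) =
  history_prob n s * ((a + (count id s)%:R) / (a + b + n%:R)).
Proof.
apply: EFin_inj; rewrite history_probE history_rcons EFinM history_probE.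
by rewrite -red_proportion; exact: urnD.
Qed.

Lemma history_prob_false n (s : n.-tuple bool) :
  history_prob n.+1 (rcons s false) =
  history_prob n s * ((b + (n - count id s)%:R) / (a + b + n%:R)).
Proof.
have kn : (count id s <= n)%N by rewrite -[leqRHS](size_tuple s) count_size.
have split_prob : history_prob n s =
    history_prob n.+1 (rcons s true) + history_prob n.+1 (rcons s false).
  apply: EFin_inj; rewrite EFinD !history_probE -measureU.
  - by congr (P _); rewrite !history_rcons -setIUr; apply/seteqP; split => t /=;
      [case: (D n.+1 t) => ?; split=> //; [left|right]|case].
  - exact: measurable_history.
  - exact: measurable_history.
  - rewrite !history_rcons; apply/seteqP; split => t //= [[_ ->] [_]].
    by [].
have -> : history_prob n.+1 (rcons s false) =
    history_prob n s - history_prob n.+1 (rcons s true).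
  by rewrite split_prob addrC addKr.
rewrite history_prob_true natrB//; field.
by rewrite gt_eqF.
Qed.

(** Conditioning on the first [n] draws. *)
Lemma count_expectationS n phi : count_expectation n.+1 phi =
  count_expectation n (fun k => ((a + k%:R) * phi k.+1 + (b + (n - k)%:R) * phi k)
    / (a + b + n%:R)).
Proof.
rewrite /count_expectation (big_tuple_rcons _ (fun s => history_prob n.+1 s * phi (count id s))).
apply: eq_bigr => s _; rewrite history_prob_true history_prob_false.
rewrite -!cats1 !count_cat /= !addn0 addn1.
by field; rewrite gt_eqF.
Qed.

Lemma count_expectation_eq n phi psi : (forall k, (k <= n)%N -> phi k = psi k) ->
  count_expectation n phi = count_expectation n psi.
Proof.
move=> E; apply: eq_bigr => s _; rewrite E//.
by rewrite -[leqRHS](size_tuple s) count_size.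
Qed.

Lemma count_expectationB n phi psi :
  count_expectation n (fun k => phi k - psi k) =
  count_expectation n phi - count_expectation n psi.
Proof. by rewrite -sumrB; apply: eq_bigr => s _; rewrite mulrBr. Qed.

Lemma count_expectationZr n phi x :
  count_expectation n (fun k => phi k * x) = count_expectation n phi * x.
Proof. by rewrite mulr_suml; apply: eq_bigr => s _; rewrite mulrA. Qed.

Lemma count_expectation0 phi : count_expectation 0 phi = phi 0%N.
Proof.
rewrite /count_expectation (bigD1 [tuple])//= big1 => [|s]; last by move=> /eqP[]; exact: tuple0.
rewrite addr0 (_ : history_prob 0 [::] = 1) ?mul1r//.
apply: EFin_inj; rewrite history_probE (_ : [set _ | _] = setT) ?probability_setT//.
by apply/seteqP; split.
Qed.

Lemma count_expectation_cst n x : count_expectation n (fun=> x) = x.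
Proof.
elim: n => [|n IHn]; first by rewrite count_expectation0.
rewrite count_expectationS -[RHS]IHn; apply: count_expectation_eq => k kn.
by rewrite natrB//; field; rewrite gt_eqF.
Qed.

Lemma count_expectation_norm_le n phi M :
  (forall k, (k <= n)%N -> `|phi k| <= M) -> `|count_expectation n phi| <= M.
Proof.
move=> phiM; rewrite -(count_expectation_cst n M).
apply: le_trans (ler_norm_sum _ _ _) _; apply: ler_sum => s _.
rewrite normrM (ger0_norm (history_prob_ge0 _ _)) ler_wpM2l ?history_prob_ge0//.
by apply: phiM; rewrite -[leqRHS](size_tuple s) count_size.
Qed.

(** The induction avoids the explicit law of the number of red draws: by
    [count_expectationS], the balance equation for [g] after [n + 1] draws is the
    balance equation after [n] draws for the function [g'] below. *)
Lemma birth_death_balance n (g : nat -> R) :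
  count_expectation n (fun k => birth a n k * g k - death b n k * g k.-1) = 0.
Proof.
elim: n g => [|n IHn] g.
  by rewrite count_expectation0 /birth /death subnn !mul0r subrr.
rewrite count_expectationS.
pose g' (k : nat) := (a + k.+1%:R) * g k.+1 + (b + (n - k)%:R) * g k.
transitivity (count_expectation n
    (fun k => (birth a n k * g' k - death b n k * g' k.-1) / (a + b + n%:R))).
  apply: count_expectation_eq => k kn; congr (_ / _).
  rewrite /birth /death /g' subSS (subSn kn).
  case: k kn => [|k] kn; first by rewrite subn0 -!natr1; ring.
  rewrite /= (_ : (n - k = (n - k.+1).+1)%N); last by rewrite subnSK.
  by rewrite -!natr1; ring.
by rewrite count_expectationZr IHn mul0r.
Qed.

End polya_histories.

(** * The rate of convergence *)

Section stein_solution_norms.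
Context {R : realType}.
Implicit Types x y : R.
Variables (a b C1 C2 L N : R) (h : R -> R).
Hypotheses (a0 : 0 < a) (b0 : 0 < b) (C12 : stein_bounds a b C1 C2).
Hypotheses (hd : twice_diff_bounded h).
Hypotheses (hLE : lip_norm h = L%:E) (hL : L.-lipschitz h).
Hypotheses (hNE : sup_norm h^`(2) = N%:E) (hN : N.-lipschitz h^`()).

Let f := stein_sol a b h.
Let F := stein_sol (a + 1) (b + 1) (stein_next a b h).

Let a1 : 0 < a + 1. Proof. by rewrite addr_gt0. Qed.
Let b1 : 0 < b + 1. Proof. by rewrite addr_gt0. Qed.

Let dh : forall x, derivable h x 1. Proof. by case: hd. Qed.

Let is_derive_f x : x != 0 -> x != 1 -> is_derive x 1 f (F x).
Proof.
move=> x0 x1; rewrite (_ : F x = f^`() x); last exact: (esym (derive1_stein_sol a0 b0 hL dh hN x0 x1)).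
have [df _] := is_derive1_stein_sol a0 b0 hL x0 x1.
exact: derivable_is_derive1.
Qed.

Lemma klipschitz_stein_sol_le : (C1 * L).-lipschitz f.
Proof.
apply: (klipschitz_ae_derive (klipschitz_stein_sol a0 b0 hL)).
have [|df] := C12.1 h; first by apply/lipschitzP; exists L.
rewrite hLE -EFinM => /sup_normP fC1.
by move: (ae_conj df fC1); apply: ae_imply.
Qed.

Lemma klipschitz_derive_stein_sol_le : (C2 * (L + N)).-lipschitz F.
Proof.
have hn := klipschitz_stein_next a0 b0 hL hN.
apply: (klipschitz_ae_derive (klipschitz_stein_sol a1 b1 hn)).
have [_] := C12.2 h hd.
have -> : (lip_norm h + sup_norm h^`(2))%E = (L + N)%:E by rewrite hLE hNE.
rewrite -EFinM => /sup_normP fC2.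
move: (ae_conj (ae_notin [:: 0; 1]) fC2); apply: ae_imply => x [].
rewrite !inE negb_or => /andP[x0 x1].
have -> : (stein_sol a b h)^`(2)%classic x = ((stein_sol a b h)^`()^`())%classic x by [].
rewrite (is_derive1E (is_derive1_derive_stein_sol a0 b0 hL dh hN x0 x1)) => Fx.
by split => //; have [] := is_derive1_stein_sol a1 b1 hn x0 x1.
Qed.

(** [F] is the derivative of the Lipschitz function [f] outside 0 and 1, and the
    bound extends to these two points by continuity of [F]. *)
Lemma derive_stein_sol_le x : `|F x| <= C1 * L.
Proof.
have off y : y != 0 -> y != 1 -> `|F y| <= C1 * L.
  move=> y0 y1; rewrite -(is_derive1E (is_derive_f y0 y1)).
  by apply: (klipschitz_derivable klipschitz_stein_sol_le); case: (is_derive_f y0 y1).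
have [x01|] := boolP ((x == 0) || (x == 1)); last first.
  by rewrite negb_or => /andP[]; exact: off.
have B0 := klipschitz_ge0 klipschitz_derive_stein_sol_le.
pose B := C2 * (L + N).
apply/ler_addgt0Pr => e e0.
(* a point other than 0 and 1, at which [F] differs from [F x] by at most [e] *)
pose y := x + Num.min (2^-1) (e / (B + 1)).
have B1 : 0 < B + 1 by rewrite ltr_wpDl.
have m0 : 0 < Num.min 2^-1 (e / (B + 1)) by rewrite lt_min divr_gt0// andbT.
have m2 : Num.min 2^-1 (e / (B + 1)) <= 2^-1 by rewrite ge_min lexx.
have me : Num.min 2^-1 (e / (B + 1)) <= e / (B + 1) by rewrite ge_min lexx orbT.
have [y0 y1] : y != 0 /\ y != 1.
  rewrite /y; move: m0 m2; set t := Num.min _ _ => t0 t2.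
  by case/orP: x01 => /eqP ->; split; apply/eqP; lra.
rewrite -[F x](subrKC (F y)).
apply: le_trans (ler_normD _ _) _; apply: lerD; first exact: off.
apply: le_trans ((klipschitzP _ _).1 klipschitz_derive_stein_sol_le x y) _.
rewrite -/B distrC /y (addrC x) addrK (gtr0_norm m0).
apply: (@le_trans _ _ (B * (e / (B + 1)))); first by rewrite ler_wpM2l.
rewrite mulrCA ler_piMr ?(ltW e0)// ler_pdivrMr// mul1r; lra.
Qed.

Lemma stein_equation x : 0 <= x -> x <= 1 ->
  x * (1 - x) * F x + (a - (a + b) * x) * f x = h x - beta_mean a b h.
Proof.
move=> x0 x1; have [->|x0'] := eqVneq x 0.
  rewrite !mul0r add0r mulr0 subr0 /f /stein_sol ltxx eqxx.
  by rewrite mulrC divfK// gt_eqF.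
have [->|x1'] := eqVneq x 1.
  rewrite subrr mulr0 mul0r add0r mulr1 /f /stein_sol ltNge ler01/= oner_eq0 ltxx eqxx.
  by field; rewrite gt_eqF.
have -> : F x = stein_slope a b h x.
  exact: (esym (stein_slope_next a0 b0 hL dh hN x0' x1')).
rewrite /stein_slope -/(f x).
have nx1 : 1 - x != 0 by rewrite subr_eq0 eq_sym.
by field; rewrite ?nx1 ?x0'.
Qed.

(** The error is the expectation of the Stein operator applied to [f]. Subtracting
    the generator of the chain applied to a primitive of [f], of expectation 0,
    reduces the claim to the pointwise bound [birth_death_step]. *)
Lemma count_expectation_stein_le (d : measure_display) (T : measurableType d)
    (P : probability T R) (D : nat -> {RV P >-> bool}) (r w c n : nat) :
  (0 < r)%N -> (0 < w)%N -> (0 < c)%N -> polya_urn r w c D ->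
  a = r%:R / c%:R -> b = w%:R / c%:R -> (0 < n)%N ->
  `|count_expectation D n (fun k => h (k%:R / n%:R)) - beta_mean a b h| <=
    stein_rate a b (C1 * L) (C2 * (L + N)) n.
Proof.
move=> r0 w0 c0 urnD aE bE n0.
have cf : continuous f by exact: klipschitz_continuous klipschitz_stein_sol_le.
have [G dG] := @continuous_primitive R f (-1) 2 cf.
have in12 x : 0 <= x -> x <= 1 -> x \in `](-1), 2[%R.
  by move=> x0 x1; rewrite in_itv/=; apply/andP; split; lra.
have df (t : R) : t \notin [:: 0; 1] -> is_derive t 1 f (F t).
  by rewrite !inE negb_or => /andP[]; exact: is_derive_f.
pose x (k : nat) : R := k%:R / n%:R.
pose g (k : nat) := G (x k.+1) - G (x k).
have mean_cst := count_expectation_cst r0 w0 c0 urnD n (beta_mean a b h).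
have balance := birth_death_balance r0 w0 c0 urnD n g.
rewrite -aE -bE in balance.
rewrite -mean_cst -count_expectationB -[X in `|X|]subr0 -balance -count_expectationB.
apply: (count_expectation_norm_le r0 w0 c0 urnD) => k kn.
have nR0 : 0 < n%:R :> R by rewrite ltr0n.
have x0 : 0 <= x k by rewrite divr_ge0// ltW.
have x1 : x k <= 1 by rewrite ler_pdivrMr// mul1r ler_nat.
rewrite -(stein_equation x0 x1).
rewrite (_ : death b n k * g k.-1 = death b n k * (G (x k) - G (x k.-1))); last first.
  by case: k {kn x0 x1} => [|k]; rewrite ?/death ?mul0r.
apply: birth_death_step => //.
- exact: klipschitz_ge0 klipschitz_derive_stein_sol_le.
- exact: derive_stein_sol_le.
- move=> y t y0 y1 t0 t1.
  by apply: (taylor2 cf klipschitz_derive_stein_sol_le df dG); exact: in12.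
Qed.

End stein_solution_norms.

Unset Implicit Arguments.

Theorem theorem4p3 (R : realType) :
  exists K1 K2 : R -> R -> R,
  forall r w c : nat, (1 <= r)%N -> (1 <= w)%N -> (1 <= c)%N ->
  let a : R := r%:R / c%:R in
  let b : R := w%:R / c%:R in
  [/\ stein_bounds a b (K1 a b) (K2 a b),
      forall C1 C2 : R, stein_bounds a b C1 C2 ->
      forall (d : measure_display) (T : measurableType d)
        (P : probability T R) (D : nat -> {RV P >-> bool}),
      polya_urn r w c D ->
      forall (n : nat) (h : R -> R), (1 <= n)%N -> twice_diff_bounded h ->
      (`| 'E_P[h \o red_freq D n] - (beta_mean a b h)%:E | <=
         (C1%:E * lip_norm h * ((`|a - b| + a) / 2)%:E +
          C2%:E * (lip_norm h + sup_norm h^`(2)) *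
            (6^-1 + (a + b - 1) / (6 * n%:R))%:E) * (n%:R^-1)%:E)%E
    & forall (d : measure_display) (T : measurableType d)
        (P : probability T R) (D : nat -> {RV P >-> bool}),
      polya_urn r w c D ->
      forall h : R -> R, twice_diff_bounded h ->
      (fun n : nat =>
         fine `| 'E_P[h \o red_freq D n] - (beta_mean a b h)%:E |%E)
        =O_\oo (fun n : nat => n%:R^-1 : R)].
Proof.
exists stein_const1, stein_const2 => r w c r0 w0 c0 a b.
have a0 : 0 < a by rewrite divr_gt0 ?ltr0n.
have b0 : 0 < b by rewrite divr_gt0 ?ltr0n.
have bounds := stein_bounds_const a0 b0.
split => //.
- move=> C1 C2 C12 d T P D urnD n h n0 hd.
  have [L [N [LE hL NE hN]]] := twice_diff_bounded_norms hd.
  rewrite expectation_red_freq LE NE -EFinB -!(EFinM, EFinD) lee_fin.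
  exact: (count_expectation_stein_le a0 b0 C12 hd LE hL NE hN r0 w0 c0 urnD).
- move=> d T P D urnD h hd.
  have [L [N [LE hL NE hN]]] := twice_diff_bounded_norms hd.
  pose A := stein_const1 a b * L; pose B := stein_const2 a b * (L + N).
  have A0 : 0 <= A by exact: klipschitz_ge0 (klipschitz_stein_sol_le a0 b0 bounds LE hL).
  have B0 : 0 <= B by exact: klipschitz_ge0 (klipschitz_derive_stein_sol_le a0 b0 bounds hd LE hL NE hN).
  apply/eqO_exP; exists (A * ((`|a - b| + a) / 2) + B * (6^-1 + (a + b)) + 1).
    have d1 : 0 <= (`|a - b| + a) / 2 by rewrite divr_ge0 ?addr_ge0// ltW.
    have d2 : 0 <= 6^-1 + (a + b) by rewrite !addr_ge0 ?(ltW a0) ?(ltW b0).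
    by rewrite ltr_wpDl ?ltr01// addr_ge0 ?(mulr_ge0 A0 d1) ?(mulr_ge0 B0 d2).
  near=> n.
  have n0 : (1 <= n)%N by near: n; exact: nbhs_infty_ge.
  rewrite expectation_red_freq -EFinB /= normr_id.
  have nR1 : 1 <= n%:R :> R by rewrite ler1n.
  have nR0 : 0 < n%:R :> R by rewrite ltr0n.
  apply: le_trans (count_expectation_stein_le a0 b0 bounds hd LE hL NE hN r0 w0 c0 urnD _ _ n0) _ => //.
  rewrite /stein_rate -/A -/B (@ger0_norm _ n%:R^-1) ?invr_ge0// ler_wpM2r ?invr_ge0//.
  rewrite -[leRHS]addrA lerD2l (@le_trans _ _ (B * (6^-1 + (a + b))))//; last by rewrite lerDl.
  rewrite ler_wpM2l// lerD2l ler_pdivrMr ?mulr_gt0//.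
  have ab : 0 < a + b by rewrite addr_gt0.
  have : (a + b) * 1 <= (a + b) * (6 * n%:R) by rewrite ler_wpM2l ?ltW//; lra.
  lra.
Unshelve. all: by end_near. Qed.
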